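(* Let $p\ge3$ be a prime. (i) For all $n,k\ge0$ with $p\nmid n$, $$b\!\left(18p^{2\nu(p)(k+1)-1}n+\frac{9p^{2\nu(p)(k+1)}-1}{2}\right)\equiv 0\pmod{72}.$$ (ii) For all $k\ge0$, $$b\!\left(18p^{2\nu(p)k}+\frac{9p^{2\nu(p)k}-1}{2}\right)\equiv 36\,g(p)^k\pmod{72}.$$
   Context: The mock theta function $\mathcal{B}(q)=\sum_{n\ge0}\frac{q^n(-q;q^2)_n}{(q;q^2)_{n+1}}=\sum_{n\ge0}b(n)q^n$, $(a;q)_n=\prod_{j=0}^{n-1}(1-aq^j)$. The integers $a(n)$ are defined by $\sum_{n\ge0}a(n)q^n=f_1^4f_2$, $f_m:=(q^m;q^m)_\infty$. For a prime $p\ge3$: $r=r(p):=a\!\left(\frac{p^2-1}{4}\right)+(-1)^{\frac{p-1}{2}}\,p\left(\frac{(p^2-1)/4}{p}\right)$ (Legendre symbol), $s=s(p):=p^3$; $r$ is even. Set $\nu(p)=2$ if $r\equiv0\pmod 8$, $\nu(p)=4$ if $r\equiv4\pmod8$, $\nu(p)=8$ if $r\equiv2\pmod4$; and $g(p)=-s$ if $\nu(p)=2$, $g(p)=-r^2s+s^2$ if $\nu(p)=4$, $g(p)=-r^6s+5s^2r^4-6r^2s^3+s^4$ if $\nu(p)=8$. *)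

(* Defs.v *)
From mathcomp Require Import all_boot all_order all_algebra.
Set Implicit Arguments. Unset Strict Implicit. Unset Printing Implicit Defensive.
Import Order.TTheory GRing.Theory Num.Theory.
Local Open Scope ring_scope.

(* Truncated formal power series are represented by polynomials over int.
   All factors below have only nonnegative exponents, so the coefficient of
   q^N computed from truncations to order N is exact. *)

(* geom a N = 1 + q^a + q^(2a) + ... + q^(aN): truncation of 1/(1-q^a), a >= 1 *)
Definition geom (a N : nat) : {poly int} := \sum_(i < N.+1) 'X^(a * i).

(* truncation (mod q^(N+1)) of  q^m (-q;q^2)_m / (q;q^2)_(m+1) *)
Definition Bterm (m N : nat) : {poly int} :=
  'X^m * (\prod_(j < m) (1 + 'X^(2 * j + 1)%N))
       * (\prod_(j < m.+1) geom (2 * j + 1)%N N).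

(* b n = coefficient of q^n in B(q) = sum_{m>=0} q^m (-q;q^2)_m/(q;q^2)_{m+1};
   only the terms m <= n contribute to q^n. *)
Definition b (n : nat) : int := (\sum_(m < n.+1) Bterm m n)`_n.

(* a n = coefficient of q^n in f_1^4 f_2 = prod_{j>=1} (1-q^j)^4 (1-q^{2j});
   only factors with j <= n matter. *)
Definition a (n : nat) : int :=
  (\prod_(j < n) ((1 - 'X^(j.+1)) ^+ 4 * (1 - 'X^(2 * j.+1)%N)))`_n.

Definition legendre (x p : nat) : int :=
  if (x %% p == 0)%N then 0
  else if [exists y : 'I_p, (y * y %% p == x %% p)%N] then 1 else -1.

Definition rr (p : nat) : int :=
  a ((p ^ 2 - 1) %/ 4) + (-1) ^+ ((p - 1) %/ 2) * (p%:Z) * legendre ((p ^ 2 - 1) %/ 4) p.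

Definition ss (p : nat) : int := (p%:Z) ^+ 3.

Definition nu (p : nat) : nat :=
  if (rr p %% 8)%Z == 0 then 2%N
  else if (rr p %% 8)%Z == 4 then 4%N
  else 8%N.

Definition g (p : nat) : int :=
  let r := rr p in let s := ss p in
  if nu p == 2%N then - s
  else if nu p == 4%N then - r ^+ 2 * s + s ^+ 2
  else - r ^+ 6 * s + 5 * s ^+ 2 * r ^+ 4 - 6 * r ^+ 2 * s ^+ 3 + s ^+ 4.

(* Main.v *)
(* With [B(q) = sum b(n) q^n], the sum [B(q) + B(-q)] is a bilateral series of the
   kind summed by Ramanujan's 1psi1 formula (in the Andrews-Askey way: a first-order
   recurrence in the parameter, compared with the q-binomial theorem).  With
   [phi(q) = sum_(k in Z) q^(k^2)] and [psi(q) = sum_(k >= 0) q^(k(k+1)/2)] it gives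
     [sum b(2m) q^m = psi(q)^2 / phi(-q) = psi(q^2) phi(q) / phi(-q)].
   The 3-dissections of [phi] and [psi] show that 9 divides b(2m) if m = 2 mod 3, and
   the 2-dissection of [phi] gives
     [sum b(2m) q^m = psi(q^2) (1 + 4 q psi(q^8)) mod 8].
   So if N = 4m + 1 is not a square, b(2m) mod 8 is 4 times the number of
   representations N = x^2 + 4 z^2 with x, z odd and positive; by Zagier's involution
   this number has the parity of the number of divisors d of N with d^2 < N when
   N = 5 mod 8, and it is 0 when N = 1 mod 8.  For the N of the theorem this parity
   is read off from the exponent of p in N; of nu(p) one only uses that it is even,
   and of g(p) that it is odd.

   Power series in q truncated at order M are elements of a commutative ring in
   which q^M = 0, so that all infinite sums and products are finite and 1/(1 - y)
   is [geos M y] for every y with y^M = 0. *)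
Require Import Defs.
From mathcomp Require Import all_boot all_order all_algebra qpoly.
From mathcomp Require Import ring zify.
Set Implicit Arguments. Unset Strict Implicit. Unset Printing Implicit Defensive.
Import GRing.Theory Num.Theory.
Local Open Scope ring_scope.

(** * A bilateral summation and the even part of B *)

Lemma expr_nil (R : comNzRingType) (q : R) (M n : nat) :
  q ^+ M = 0 -> (M <= n)%N -> q ^+ n = 0.
Proof. by move=> qM /subnK <-; rewrite exprD qM mulr0. Qed.

Lemma nil_expr (R : comNzRingType) (q : R) (M n : nat) :
  q ^+ M = 0 -> (0 < n)%N -> (q ^+ n) ^+ M = 0.
Proof. by move=> qM n0; rewrite -exprM (expr_nil qM) // leq_pmull. Qed.

Definition geos (R : comNzRingType) (M : nat) (y : R) : R := \sum_(i < M) y ^+ i.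

Lemma geosP (R : comNzRingType) (M : nat) (y : R) :
  y ^+ M = 0 -> (1 - y) * geos M y = 1.
Proof. by move=> yM; rewrite -opprB mulNr -subrX1 yM sub0r opprK. Qed.

Section Contiguous.
Context (R : comNzRingType) (q : R) (M : nat).
Hypothesis qM : q ^+ M = 0.

Local Notation iv := (geos M).

(* [psi11 x] is the sum of [(-q;q^2)_n q^n / (x q^2;q^2)_n] over all integers n; its
   terms of index n and -n-1 (n >= 0) are [psi_pos x n] and [psi_neg x n]. *)
Definition psi_pos (x : R) (n : nat) : R :=
  q ^+ n * \prod_(j < n) (1 + q ^+ (2 * j + 1)) * \prod_(j < n) iv (x * q ^+ (2 * j + 2)).

Definition psi_neg (x : R) (n : nat) : R :=
  \prod_(j < n.+1) (q ^+ (2 * j) - x) * \prod_(j < n.+1) iv (- q ^+ (2 * j + 1)).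

Definition psi11 (x : R) : R :=
  \sum_(n < M.+1) psi_pos x n + \sum_(n < M.+1) psi_neg x n.

Lemma geos_mulX (z : R) (n : nat) : (0 < n)%N -> (1 - z * q ^+ n) * iv (z * q ^+ n) = 1.
Proof. by move=> n0; rewrite geosP // exprMn nil_expr // mulr0. Qed.

(** The expansions W - xZ and qW + Z of [psi11 x] give (1 + x) psi11(x) = (1 + qx) W on eliminating
    Z, while psi11(q^2 x) = (1 - q^2 x) W. The hypothesis kills the boundary term of the index
    shift. *)
Lemma psi11_contiguous (x : R) :
  psi_neg x M = 0 ->
  (1 + x) * (1 - q ^+ 2 * x) * psi11 x = (1 + q * x) * psi11 (q ^+ 2 * x).
Proof.
move=> xM.
(* [wp n] and [q^(2n) y n] are the terms of index i = n and i = -n-1 with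
   denominator [(x q^2;q^2)_(i+1)]; E1 compares the two series termwise, E2 after an index shift. *)
pose wp n := q ^+ n * \prod_(j < n) (1 + q ^+ (2 * j + 1))
             * \prod_(j < n.+1) iv (x * q ^+ (2 * j + 2)).
pose y n := \prod_(j < n) (q ^+ (2 * j) - x) * \prod_(j < n.+1) iv (- q ^+ (2 * j + 1)).
have wpE n : psi_pos (q ^+ 2 * x) n = (1 - q ^+ 2 * x) * wp n.
  rewrite /psi_pos /wp big_ord_recl /= muln0 add0n.
  transitivity (q ^+ n * \prod_(j < n) (1 + q ^+ (2 * j + 1)) *
      (((1 - x * q ^+ 2) * iv (x * q ^+ 2)) *
      \prod_(i < n) iv (x * q ^+ (2 * bump 0 i + 2)))); last by ring.
  rewrite geos_mulX // mul1r; congr (_ * _); apply: eq_bigr => j _; congr iv.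
  have -> : (2 * bump 0 j + 2 = 2 + (2 * j + 2))%N by rewrite /bump; lia.
  by rewrite !exprD; ring.
have wmE n : psi_neg (q ^+ 2 * x) n = (1 - q ^+ 2 * x) * (q ^+ (2 * n) * y n).
  rewrite /psi_neg /y big_ord_recl /= muln0 expr0 !mulrA.
  rewrite -[in RHS](mulrA (1 - q ^+ 2 * x)); congr (_ * _ * _).
  rewrite exprM -[n in X in _ = X * _]card_ord -prodr_const -big_split /=.
  apply: eq_bigr => j _.
  have -> : (2 * bump 0 j = 2 + 2 * j)%N by rewrite /bump; lia.
  by rewrite exprD; ring.
have wpS n : psi_pos x n.+1 = q * wp n + q ^+ (2 * n + 2) * wp n.
  by rewrite /psi_pos /wp (big_ord_recr n) /= !exprD exprS; ring.
have wp0 n : psi_pos x n = wp n - x * q ^+ (2 * n + 2) * wp n.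
  have -> : wp n = psi_pos x n * iv (x * q ^+ (2 * n + 2)).
    by rewrite /wp /psi_pos big_ord_recr /= !mulrA.
  have E : (1 - x * q ^+ (2 * n + 2)) * iv (x * q ^+ (2 * n + 2)) = 1 by rewrite geos_mulX // addn2.
  by rewrite -[LHS]mulr1 -E; ring.
have wm0 n : psi_neg x n = q ^+ (2 * n) * y n - x * y n.
  by rewrite /psi_neg /y (big_ord_recr n) /=; ring.
have iv1 n : (1 + q ^+ (2 * n + 1)) * iv (- q ^+ (2 * n + 1)) = 1.
  by rewrite -[RHS](@geos_mulX (-1) (2 * n + 1)) ?addn1 // !mulN1r opprK.
(* The shift carries the term of index 0, equal to 1, from one half of the bilateral series to the
   other. *)
have y0 : q * y 0%N + y 0%N = 1.
  rewrite /y big_ord0 big_ord_recl big_ord0 -[RHS](iv1 0%N) /=.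
  by rewrite muln0 add0n expr1; ring.
have yS n : q * (q ^+ (2 * n.+1) * y n.+1) + y n.+1 = psi_neg x n.
  rewrite /y /psi_neg (big_ord_recr n.+1) /=.
  set a := \prod_(j < n.+1) _; set c := \prod_(j < n.+1) _.
  transitivity (a * c * ((1 + q ^+ (2 * n.+1 + 1)) * iv (- q ^+ (2 * n.+1 + 1)))).
    by rewrite exprD expr1; ring.
  by rewrite iv1 mulr1.
pose W := \sum_(n < M.+1) wp n + \sum_(n < M.+1) q ^+ (2 * n) * y n.
pose Z := \sum_(n < M.+1) q ^+ (2 * n + 2) * wp n + \sum_(n < M.+1) y n.
have E1 : psi11 x = W - x * Z.
  rewrite /psi11 /W /Z mulrDr opprD addrACA; congr (_ + _).
    by rewrite mulr_sumr -sumrB; apply: eq_bigr => n _; rewrite wp0 !mulrA.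
  by rewrite mulr_sumr -sumrB; apply: eq_bigr => n _; rewrite wm0.
have E2 : psi11 x = q * W + Z.
  rewrite /psi11.
  have -> : \sum_(n < M.+1) psi_pos x n
      = 1 + \sum_(n < M.+1) (q * wp n + q ^+ (2 * n + 2) * wp n).
    rewrite big_ord_recl [in RHS]big_ord_recr /= -wpS.
    rewrite [X in _ + (_ + X)](_ : _ = 0) ?addr0.
      congr (_ + _); first by rewrite /psi_pos !big_ord0 !mulr1.
      by apply: eq_bigr => n _; rewrite -wpS.
    by rewrite /psi_pos exprS qM mulr0 !mul0r.
  have E : 1 + \sum_(n < M.+1) psi_neg x n
      = \sum_(n < M.+1) (q * (q ^+ (2 * n) * y n) + y n).
    rewrite big_ord_recr /= xM addr0 [in RHS]big_ord_recl /= muln0 expr0 mul1r y0.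
    by congr (_ + _); apply: eq_bigr => n _; rewrite -yS.
  have -> : \sum_(n < M.+1) psi_neg x n
     = \sum_(n < M.+1) (q * (q ^+ (2 * n) * y n) + y n) - 1 by rewrite -E; ring.
  by rewrite /W /Z !big_split /= -!mulr_sumr; ring.
have E3 : psi11 (q ^+ 2 * x) = (1 - q ^+ 2 * x) * W.
  rewrite /psi11 /W mulrDr !mulr_sumr.
  by congr (_ + _); apply: eq_bigr => n _; rewrite ?wpE ?wmE.
rewrite E3; have -> : (1 + q * x) * ((1 - q ^+ 2 * x) * W) = (1 - q ^+ 2 * x) * ((1 + q * x) * W) by ring.
have -> : (1 + q * x) * W = W - x * Z + x * (q * W + Z) by ring.
by rewrite -E1 -E2; ring.
Qed.

End Contiguous.

(** This is (-y; z)_infinity when z^M = 0, all factors with j >= M being 1; so (y; z)_infinity is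
    [poch M (- y) z]. *)
Definition poch (R : comNzRingType) (M : nat) (y z : R) : R := \prod_(j < M) (1 + y * z ^+ j).

Lemma poch_ge (R : comNzRingType) (M n : nat) (y z : R) :
  z ^+ M = 0 -> (M <= n)%N -> poch n y z = poch M y z.
Proof.
move=> zM /subnKC <-; elim: (n - M)%N => [|k IHk]; first by rewrite addn0.
by rewrite addnS /poch big_ord_recr /= exprD zM mul0r mulr0 addr0 mulr1.
Qed.

Lemma poch_shift (R : comNzRingType) (M : nat) (y z : R) :
  z ^+ M = 0 -> (1 + y) * poch M (y * z) z = poch M y z.
Proof.
move=> zM; rewrite -[RHS](@poch_ge _ M M.+1) // /poch big_ord_recl expr0 mulr1.
by congr (_ * _); apply: eq_bigr => j _; rewrite -mulrA -exprS.
Qed.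

(** The sum h(t) satisfies (1 - t) h(t) = (1 + at) h(tz); iterating M times moves the argument to t
    z^M = 0, where h is 1. *)
Lemma q_binomial (R : comNzRingType) (M : nat) (a t z : R) :
  t ^+ M = 0 -> z ^+ M = 0 ->
  poch M (- t) z * \sum_(n < M.+1) t ^+ n * \prod_(j < n) (1 + a * z ^+ j)
                       * \prod_(j < n) geos M (z ^+ j.+1)
  = poch M (a * t) z.
Proof.
move=> tM zM.
pose d n := \prod_(j < n) (1 + a * z ^+ j) * \prod_(j < n) geos M (z ^+ j.+1).
pose h t := \sum_(n < M.+1) t ^+ n * d n.
have dS n : d n.+1 * (1 - z ^+ n.+1) = d n * (1 + a * z ^+ n).
  have E : (1 - z ^+ n.+1) * geos M (z ^+ n.+1) = 1 by rewrite geosP // nil_expr.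
  by rewrite -[RHS]mulr1 -[X in _ = _ * X]E /d !big_ord_recr /=; ring.
have hS u : u ^+ M = 0 -> (1 - u) * h u = (1 + a * u) * h (u * z).
  move=> uM; suff E : h u - h (u * z) = u * h u + a * u * h (u * z).
    apply/eqP; rewrite -subr_eq0; apply/eqP.
    transitivity (h u - h (u * z) - (u * h u + a * u * h (u * z))); first by ring.
    by rewrite E subrr.
  rewrite /h -sumrB big_ord_recl !expr0 subrr add0r !mulr_sumr -big_split /=.
  rewrite [RHS]big_ord_recr /= exprMn uM !(mul0r, mulr0, addr0).
  apply: eq_bigr => n _; rewrite /bump /= add1n !exprMn.
  transitivity (u ^+ n.+1 * (d n.+1 * (1 - z ^+ n.+1))); first by ring.
  by rewrite dS exprS; ring.
have hk k : \prod_(j < k) (1 - t * z ^+ j) * h t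
          = \prod_(j < k) (1 + a * (t * z ^+ j)) * h (t * z ^+ k).
  elim: k => [|k IHk]; first by rewrite !big_ord0 !mul1r expr0 mulr1.
  rewrite !big_ord_recr /= mulrAC IHk mulrAC -mulrA hS.
    by rewrite exprSr !mulrA.
  by rewrite exprMn tM mul0r.
have := hk M; rewrite zM mulr0.
have -> : h 0 = 1.
  rewrite /h big_ord_recl expr0 mul1r /d !big_ord0 mulr1 big1 ?addr0 // => n _.
  by rewrite expr0n mul0r.
rewrite mulr1 => E; rewrite /poch.
under eq_bigr do rewrite mulNr.
under [in RHS]eq_bigr do rewrite -mulrA.
by rewrite -E; congr (_ * _); apply: eq_bigr => n _; rewrite mulrA.
Qed.

Section EvenPart.
Context (R : comNzRingType) (q : R) (M : nat).
Hypothesis qM : q ^+ M = 0.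

Local Notation P := (poch M).
Local Notation psi := (psi11 q M).

(** Supplies the hypothesis of [psi11_contiguous]: for m = 0 the factor j = 0 vanishes, and for m >
    0 each of the M factors with j > 0 contains q. *)
Lemma psi_neg_expr (m : nat) : psi_neg q M (q ^+ m) M = 0.
Proof.
rewrite /psi_neg big_ord_recl muln0 expr0.
case: m => [|m]; first by rewrite subrr !mul0r.
have -> : \prod_(j < M) (q ^+ (2 * lift ord0 j) - q ^+ m.+1)
    = \prod_(j < M) (q * (q ^+ (2 * j + 1) - q ^+ m)).
  apply: eq_bigr => j _; rewrite /= /bump /= mulrBr -!exprS.
  by congr (q ^+ _ - _); lia.
by rewrite big_split /= prodr_const card_ord qM !(mul0r, mulr0).
Qed.

(** Iterating x -> q^2 x from q^m reaches 0 after M steps. The cases m = 0 and m = 1 tie the values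
    at 1 and at q to the same value at 0. *)
Lemma psi11_iter (m : nat) :
  P (q ^+ m) (q ^+ 2) * P (- q ^+ m.+2) (q ^+ 2) * psi (q ^+ m)
  = P (q ^+ m.+1) (q ^+ 2) * psi 0.
Proof.
pose x j := q ^+ (m + 2 * j).
have hk k : \prod_(j < k) (1 + x j) * \prod_(j < k) (1 - q ^+ 2 * x j) * psi (q ^+ m)
          = \prod_(j < k) (1 + q * x j) * psi (x k).
  elim: k => [|k IHk]; first by rewrite !big_ord0 !mul1r /x muln0 addn0.
  rewrite !big_ord_recr /=.
  transitivity ((1 + x k) * (1 - q ^+ 2 * x k) *
     (\prod_(j < k) (1 + x j) * \prod_(j < k) (1 - q ^+ 2 * x j) * psi (q ^+ m))).
    by ring.
  rewrite IHk mulrCA psi11_contiguous ?psi_neg_expr // mulrA; congr (_ * psi _).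
  by rewrite /x -exprD; congr (_ ^+ _); lia.
have := hk M; rewrite [x M](_ : _ = 0); last by apply: (expr_nil qM); lia.
have xE j : x j = q ^+ m * (q ^+ 2) ^+ j by rewrite /x exprD exprM.
rewrite /poch => E; rewrite (eq_bigr (fun j : 'I_M => 1 + x j)); last by move=> j _; rewrite xE.
rewrite [X in _ * X * _](eq_bigr (fun j : 'I_M => 1 - q ^+ 2 * x j)); last first.
  by move=> j _; rewrite xE -addn2 exprD; ring.
by rewrite E; congr (_ * _); apply: eq_bigr => j _; rewrite xE mulrA -exprS.
Qed.

Definition mock_B (M : nat) (y : R) : R :=
  \sum_(n < M) y ^+ n * \prod_(j < n) (1 + y ^+ (2 * j + 1))
                * \prod_(j < n.+1) geos M (y ^+ (2 * j + 1)).

(** The terms of index n >= 0 give B(q) and those of index -n-1 give B(-q), each up to the factor 1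
    - q. *)
Lemma psi11_mock_B : psi q = (1 - q) * (mock_B M q + mock_B M (- q)).
Proof.
have oddN j : (- q) ^+ (2 * j + 1) = - q ^+ (2 * j + 1).
  by rewrite exprNn -signr_odd addn1 /= oddM /= expr1 mulN1r.
rewrite /psi11 mulrDr /mock_B; congr (_ + _).
  rewrite big_ord_recr /= [psi_pos _ _ _ M]/psi_pos qM !mul0r addr0 mulr_sumr.
  apply: eq_bigr => n _; rewrite /psi_pos big_ord_recl /= muln0 add0n expr1.
  have E : (1 - q) * geos M q = 1 by rewrite geosP.
  transitivity (q ^+ n * \prod_(j < n) (1 + q ^+ (2 * j + 1)) * 
     \prod_(i < n) geos M (q ^+ (2 * bump 0 i + 1)) * ((1 - q) * geos M q)); last by ring.
  rewrite E mulr1; congr (_ * _); apply: eq_bigr => j _; congr geos.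
  by rewrite /bump -exprS; congr (_ ^+ _); lia.
have nE n : psi_neg q M q n = (1 - q) * ((- q) ^+ n * \prod_(j < n) (1 + (- q) ^+ (2 * j + 1))
                * \prod_(j < n.+1) geos M ((- q) ^+ (2 * j + 1))).
  rewrite /psi_neg !mulrA [in LHS]big_ord_recl /= muln0 expr0; congr (_ * _).
    rewrite -mulrA; congr (_ * _); rewrite -[n in X in _ = X * _]card_ord -prodr_const -big_split /=.
    apply: eq_bigr => j _; rewrite oddN mulrDr mulr1 mulrNN -exprS addrC; congr (_ + _ ^+ _).
    by rewrite /bump; lia.
  by apply: eq_bigr => j _; rewrite oddN.
rewrite big_ord_recr /= nE exprNn qM mulr0 !mul0r mulr0 addr0 mulr_sumr.
by apply: eq_bigr => n _; rewrite nE.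
Qed.

(** [psi11_iter] at m = 1 and m = 0 eliminates the value at 0. At x = 1 the terms of negative index
    contain 1 - x = 0, so what remains is a one-sided series, summed by [q_binomial]; the 2 is the
    first factor of (-1; q^2)_infinity. *)
Lemma mock_B_even :
  (mock_B M q + mock_B M (- q)) * (P (- q) (q ^+ 2) * P q (q ^+ 2)) ^+ 2
  = 2 * P (q ^+ 2) (q ^+ 2) ^+ 3 * P (- q ^+ 2) (q ^+ 2).
Proof.
have q2M : (q ^+ 2) ^+ M = 0 by rewrite nil_expr.
have := psi11_iter 1; rewrite psi11_mock_B expr1.
have <- : (1 - q) * P (- q ^+ 3) (q ^+ 2) = P (- q) (q ^+ 2).
  by rewrite -(@poch_shift _ M (- q)) // mulNr -exprS.
set Bs := _ + mock_B _ _; move=> E1.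
have := psi11_iter 0; rewrite expr0 expr1.
have -> : P 1 (q ^+ 2) = 2 * P (q ^+ 2) (q ^+ 2).
  by rewrite -poch_shift // mul1r.
have := q_binomial q qM q2M.
have -> : \sum_(n < M.+1) q ^+ n * \prod_(j < n) (1 + q * (q ^+ 2) ^+ j)
   * \prod_(j < n) geos M ((q ^+ 2) ^+ j.+1) = psi 1.
  rewrite /psi11 [X in _ = _ + X]big1 ?addr0; last first.
    by move=> n _; rewrite /psi_neg big_ord_recl muln0 expr0 subrr !mul0r.
  apply: eq_bigr => n _; rewrite /psi_pos; congr (_ * _ * _).
    by apply: eq_bigr => j _; rewrite -exprM -exprS addn1.
  by apply: eq_bigr => j _; rewrite -exprM mul1r mulnS addnC.
rewrite -(@poch_shift _ M (- q)) // mulNr -exprS -expr2 => E2 E3.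
set X := P (- q ^+ 3) _ in E1 E2 *; set Q1 := P q _ in E1 E3 *.
set Q2 := P (q ^+ 2) _ in E1 E2 E3 *; set P2 := P (- q ^+ 2) _ in E3 *.
transitivity ((1 - q) * X * Q1 * (Q1 * X * ((1 - q) * Bs))); first by ring.
rewrite E1; transitivity ((1 - q) * X * Q2 * (Q1 * psi 0)); first by ring.
rewrite -E3; transitivity (2 * Q2 ^+ 2 * P2 * ((1 - q) * X * psi 1)); first by ring.
by rewrite E2; ring.
Qed.

End EvenPart.

(** * The Jacobi triple product *)

Lemma prod_double (R : comNzRingType) (n : nat) (F : nat -> R) :
  \prod_(j < 2 * n) F j = \prod_(j < n) (F (2 * j)%N * F (2 * j).+1).
Proof.
by elim: n => [|n IHn]; rewrite ?big_ord0 // mulnS addnC addn2 !big_ord_recr /= IHn mulrA.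
Qed.

Section JacobiTripleProduct.
Context (R : comNzRingType) (x y : R) (M : nat).
Let Q := x * y.
Hypothesis QM : Q ^+ M = 0.

Local Notation iv := (geos M).

Definition ipoch (m : nat) : R := \prod_(j < m) iv (Q ^+ j.+1).

Lemma ipochS (m : nat) : (1 - Q ^+ m.+1) * ipoch m.+1 = ipoch m.
Proof.
by rewrite /ipoch big_ord_recr /= mulrC -mulrA [_ * (1 - _)]mulrC geosP ?mulr1 // nil_expr.
Qed.

Lemma poch_ipoch (m : nat) : poch m (- Q) Q * ipoch m = 1.
Proof.
rewrite /poch /ipoch -big_split big1 //= => j _.
by rewrite mulNr -exprS geosP // nil_expr.
Qed.

(* [ipoch1 m.+1 = 1/(Q;Q)_m], with the convention [1/(Q;Q)_(-1) = 0]. *)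
Definition ipoch1 (m : nat) : R := if m is m'.+1 then ipoch m' else 0.

Lemma ipoch1S (m : nat) : (1 - Q ^+ m) * ipoch1 m.+1 = ipoch1 m.
Proof. by case: m => [|m]; rewrite ?expr0 ?subrr ?mul0r //= ipochS. Qed.

(* [jcoef n k = 1 / ((Q;Q)_(n+k) (Q;Q)_(n-k))], so that [(Q;Q)_(2n) * jsum n] is the
   q-binomial expansion of the product of the [(1 + x Q^j)(1 + y Q^j)], j < n. *)
Let jcoef (n k : nat) : R := ipoch (n + k) * ipoch1 (n.+1 - k).
Let jsym (k : nat) : R := Q ^+ 'C(k, 2) * (x ^+ k + y ^+ k).
Let jsum (n : nat) : R := jcoef n 0 + \sum_(k < n) jcoef n k.+1 * jsym k.+1.

Lemma jcoefS (n k : nat) : (k <= n)%N ->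
  (1 - Q ^+ (2 * n + 1)) * (1 - Q ^+ (2 * n + 2)) * jcoef n.+1 k.+1
  = (1 + Q ^+ (2 * n + 1)) * jcoef n k.+1 + Q ^+ (n - k) * jcoef n k
    + Q ^+ (n + k + 2) * jcoef n k.+2.
Proof.
move=> lekn; rewrite /jcoef !subSS subSn //.
have {lekn} [e ->] : exists e, n = (k + e)%N by exists (n - k)%N; rewrite subnKC.
rewrite !addnS !addSn !addn0 addKn; set m := (k + e + k)%N.
(* Each inverse q-factorial is expressed by the one of largest index, which leaves a polynomial
   identity in powers of Q. For e = 0 the truncated index k + e - (k + 1) is 0, where [ipoch1]
   vanishes as it should. *)
rewrite -(ipochS m) -(ipochS m.+1) -(ipoch1S e).
have -> : (2 * (k + e) = m + e)%N by rewrite /m; lia.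
case: e @m => [|e] m.
  by rewrite (_ : k + 0 - k.+1 = 0)%N ?addn0 ?exprS /=; [ring | lia].
have -> : (k + e.+1 - k.+1 = e)%N by lia.
rewrite -(ipoch1S e) -(ipoch1S e.+1) !addnS !exprS exprD; ring.
Qed.

Lemma jcoef0 (n : nat) :
  (1 - Q ^+ (2 * n + 1)) * (1 - Q ^+ (2 * n + 2)) * jcoef n.+1 0
  = (1 + Q ^+ (2 * n + 1)) * jcoef n 0 + 2 * Q ^+ (n + 1) * jcoef n 1.
Proof.
rewrite /jcoef !subn0 !addn0 subSS subn0 addnS addn0 !addn1 !addn2.
rewrite -(ipochS n) -(ipoch1S n) -(ipoch1S n.+1) mul2n -addnn !exprS exprD; ring.
Qed.

Lemma jcoef_gt (n k : nat) : (n < k)%N -> jcoef n k = 0.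
Proof. by move=> lt_nk; rewrite /jcoef (eqP lt_nk) mulr0. Qed.

Lemma jsymS (n k : nat) : (k < n)%N ->
  Q ^+ n * (x + y) * jsym k.+1 = Q ^+ (n - k.+1) * jsym k.+2 + Q ^+ (n + k.+1) * jsym k.
Proof.
move=> ltkn; have {ltkn} [e ->] : exists e, n = (k.+1 + e)%N.
  by exists (n - k.+1)%N; rewrite subnKC.
rewrite addKn /jsym !(binS _ 1) !bin1 !exprD ![x ^+ _.+1]exprS ![y ^+ _.+1]exprS.
rewrite ![Q ^+ k.+1]exprS; set a := Q ^+ _; set b := Q ^+ _; set c := Q ^+ _.
by rewrite /Q; ring.
Qed.

(** Induction step of the q-binomial expansion: the part Q^n (x + y) of the new factor shifts k by
    one in either direction ([jsymS]), and [jcoefS] says that the coefficients match. *)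
Lemma tripleS (n : nat) :
  (1 - Q ^+ (2 * n + 1)) * (1 - Q ^+ (2 * n + 2)) * jsum n.+1
  = (1 + x * Q ^+ n) * (1 + y * Q ^+ n) * jsum n.
Proof.
pose f k := (1 + Q ^+ (2 * n + 1)) * jcoef n k.
have -> : (1 + x * Q ^+ n) * (1 + y * Q ^+ n) = 1 + Q ^+ (2 * n + 1) + Q ^+ n * (x + y).
  by rewrite addn1 exprS mul2n -addnn exprD /Q; ring.
rewrite /jsum [LHS]mulrDr jcoef0 mulr_sumr.
rewrite (eq_bigr (fun k : 'I_n.+1 => f k.+1 * jsym k.+1 + Q ^+ (n - k) * jcoef n k * jsym k.+1
    + Q ^+ (n + k + 2) * jcoef n k.+2 * jsym k.+1)); last first.
  by move=> k _; rewrite mulrA jcoefS; [rewrite [LHS]mulrDl [X in X + _]mulrDl | case: k].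
have fn : f n.+1 = 0 by rewrite /f jcoef_gt // mulr0.
rewrite !big_split /= big_ord_recr /= fn mul0r addr0.
rewrite [X in _ + (_ + X + _)]big_ord_recl subn0 /=.
(* Reindexing brings in a term with [jsym 0], equal to 2; its removal cancels the last term of
   [jcoef0]. *)
have -> : \sum_(k < n.+1) Q ^+ (n + k + 2) * jcoef n k.+2 * jsym k.+1
  = \sum_(k < n) Q ^+ (n + k.+1) * jcoef n k.+1 * jsym k - 2 * Q ^+ (n + 1) * jcoef n 1.
  have s0 : jsym 0 = 2 by rewrite /jsym mul1r !expr0.
  have E : \sum_(k < n.+2) Q ^+ (n + k.+1) * jcoef n k.+1 * jsym k
         = \sum_(k < n) Q ^+ (n + k.+1) * jcoef n k.+1 * jsym k.
    by rewrite !big_ord_recr /= !jcoef_gt // !mulr0 !mul0r !addr0.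
  rewrite -E [in RHS]big_ord_recl /= s0 [_ * 2]mulrC mulrA addrAC subrr add0r.
  by apply: eq_bigr => k _; rewrite /bump /= add1n !addnS addn0.
rewrite [RHS]mulrDl [X in _ = X + _]mulrDr [X in _ = _ + X]mulrDr !mulr_sumr.
have -> : \sum_(k < n) Q ^+ n * (x + y) * (jcoef n k.+1 * jsym k.+1)
 = \sum_(k < n) Q ^+ (n - k.+1) * jcoef n k.+1 * jsym k.+2 + \sum_(k < n) Q ^+ (n + k.+1) * jcoef n k.+1 * jsym k.
  rewrite -big_split /=; apply: eq_bigr => k _; rewrite mulrCA jsymS //; ring.
have -> : \sum_(k < n) (1 + Q ^+ (2 * n + 1)) * (jcoef n k.+1 * jsym k.+1)
  = \sum_(k < n) f k.+1 * jsym k.+1 by apply: eq_bigr => k _; rewrite mulrA.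
have -> : \sum_(i < n) Q ^+ (n - lift ord0 i) * jcoef n (lift ord0 i) * jsym (lift ord0 i).+1
  = \sum_(k < n) Q ^+ (n - k.+1) * jcoef n k.+1 * jsym k.+2 by [].
have -> : jsym 1 = x + y by rewrite /jsym bin_small // expr0 mul1r !expr1.
by ring.
Qed.

Lemma jacobi_triple :
  poch M x Q * poch M y Q * poch M (- Q) Q
  = 1 + \sum_(k < M) Q ^+ 'C(k.+1, 2) * (x ^+ k.+1 + y ^+ k.+1).
Proof.
have SE n : \prod_(j < n) ((1 - Q ^+ (2 * j + 1)) * (1 - Q ^+ (2 * j + 2))) * jsum n
          = poch n x Q * poch n y Q.
  elim: n => [|n IHn].
    by rewrite /jsum /poch !big_ord0 /jcoef subn0 /= /ipoch !big_ord0 addr0 !mul1r.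
  by rewrite big_ord_recr /= -mulrA tripleS mulrCA IHn /poch !(big_ord_recr n) /=; ring.
(* With n = 2M both n + k and n - k are at least M for k <= M, so these coefficients are all
   1/(Q;Q)_infinity^2; for k > M the power of Q vanishes. *)
pose n := (M + M)%N.
have E : poch (2 * n) (- Q) Q * jsum n = poch n x Q * poch n y Q.
  rewrite -SE /poch (prod_double n (fun j => 1 + - Q * Q ^+ j)); congr (_ * _); apply: eq_bigr => j _.
  by rewrite !mulNr -!exprS addn1 addn2.
have ple a m : (M <= m)%N -> poch m a Q = poch M a Q by move=> lm; apply: poch_ge.
have := E; rewrite !ple; try by rewrite /n; lia.
move=> <-; rewrite mulrAC -mulrA /jsum mulrDr mulrDr.
have ipE m : (M <= m)%N -> ipoch m = ipoch M.
  move=> lm; rewrite -[LHS]mul1r -(poch_ipoch M) -(ple _ m lm) mulrAC poch_ipoch mul1r //.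
have gE k : (k <= M)%N -> poch M (- Q) Q * (poch M (- Q) Q * jcoef n k) = 1.
  move=> lk; rewrite /jcoef /n subSn /=; last by lia.
  rewrite !ipE; try by lia.
  by rewrite mulrCA mulrA mulrACA !poch_ipoch mulr1.
rewrite gE //; congr (_ + _).
rewrite /n.
rewrite big_split_ord /= [X in _ * (_ * (_ + X))]big1 ?addr0; last first.
  move=> k _; rewrite /jsym (expr_nil QM) ?mul0r ?mulr0 //.
  by rewrite (binS _ 1) bin1 addnCA leq_addr.
rewrite !mulr_sumr; apply: eq_bigr => k _.
by rewrite [X in _ * X]mulrA mulrA gE // mul1r.
Qed.

End JacobiTripleProduct.

(** * Theta functions *)

Lemma poch_split (R : comNzRingType) (M : nat) (y z : R) :
  z ^+ M = 0 -> poch M y z = poch M y (z ^+ 2) * poch M (y * z) (z ^+ 2).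
Proof.
move=> zM; rewrite -(@poch_ge _ M (2 * M)) ?leq_pmull //.
rewrite /poch (prod_double M (fun j => 1 + y * z ^+ j)) big_split /=.
by congr (_ * _); apply: eq_bigr => j _; rewrite -exprM // exprS mulrA.
Qed.

Lemma poch_diff (R : comNzRingType) (M : nat) (y z : R) :
  poch M y z * poch M (- y) z = poch M (- y ^+ 2) (z ^+ 2).
Proof.
by rewrite /poch -big_split; apply: eq_bigr => j _ /=; rewrite -exprM mulnC exprM; ring.
Qed.

Lemma prod_triple (R : comNzRingType) (n : nat) (F : nat -> R) :
  \prod_(j < 3 * n) F j
  = \prod_(j < n) (F (3 * j)%N * F (3 * j).+1 * F (3 * j).+2).
Proof.
elim: n => [|n IHn]; rewrite ?big_ord0 // mulnS addnC addn3 !big_ord_recr /= IHn.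
by rewrite !mulrA.
Qed.

Lemma poch_split3 (R : comNzRingType) (M : nat) (y z : R) :
  z ^+ M = 0 ->
  poch M y z = poch M y (z ^+ 3) * poch M (y * z) (z ^+ 3) * poch M (y * z ^+ 2) (z ^+ 3).
Proof.
move=> zM; rewrite -(@poch_ge _ M (3 * M)) ?leq_pmull //.
rewrite /poch (prod_triple M (fun j => 1 + y * z ^+ j)) !big_split /=.
by congr (_ * _ * _); apply: eq_bigr => j _; rewrite -exprM // !exprS; ring.
Qed.

Lemma poch_unit (R : comNzRingType) (M : nat) (y : R) :
  y ^+ M = 0 -> exists v, poch M (- y) y * v = 1.
Proof.
move=> yM; exists (\prod_(j < M) geos M (y ^+ j.+1)).
rewrite /poch -big_split big1 // => j _ /=.
by rewrite mulNr -exprS geosP // nil_expr.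
Qed.

Lemma sum_vanish (V : nmodType) (M n : nat) (F : nat -> V) :
  (forall j, (M <= j)%N -> F j = 0) -> (M <= n)%N ->
  \sum_(j < n) F j = \sum_(j < M) F j.
Proof.
move=> F0 /subnKC <-; rewrite big_split_ord /= [X in _ + X]big1 ?addr0 // => j _.
by rewrite F0 // leq_addr.
Qed.

Lemma sum_double (V : nmodType) (n : nat) (F : nat -> V) :
  \sum_(j < 2 * n) F j = \sum_(j < n) (F (2 * j)%N + F (2 * j).+1).
Proof.
by elim: n => [|n IHn]; rewrite ?big_ord0 // mulnS addnC addn2 !big_ord_recr /= IHn addrA.
Qed.

Lemma sum_triple (V : nmodType) (n : nat) (F : nat -> V) :
  \sum_(j < 3 * n) F j
  = \sum_(j < n) (F (3 * j)%N + F (3 * j).+1 + F (3 * j).+2).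
Proof.
elim: n => [|n IHn]; rewrite ?big_ord0 // mulnS addnC addn3 !big_ord_recr /= IHn.
by rewrite !addrA.
Qed.

Lemma triangularE (m : nat) : (2 * 'C(m.+1, 2) = m * m.+1)%N.
Proof. by rewrite mul2n bin2 /= mulnC -[RHS]odd_double_half oddM /= andbN. Qed.

Section Theta.
Context (R : comNzRingType) (M : nat).

Local Notation P := (poch M).

(* [theta x y] is the sum of [Q^(k(k-1)/2) x^k] over all integers k, where Q = xy;
   [theta3] is phi and [theta2] is psi. *)
Definition theta (x y : R) : R :=
  1 + \sum_(k < M) (x * y) ^+ 'C(k.+1, 2) * (x ^+ k.+1 + y ^+ k.+1).

Definition theta3 (y : R) : R := 1 + 2 * \sum_(k < M) y ^+ (k.+1 ^ 2).

Definition theta2 (y : R) : R := \sum_(m < M) y ^+ 'C(m.+1, 2).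

Lemma theta3E (y : R) : theta3 y = theta y y.
Proof.
rewrite /theta3 /theta; congr (_ + _); rewrite mulr_sumr; apply: eq_bigr => k _.
rewrite -expr2 -exprM triangularE -mulr2n mulrnAr -exprD mulr_natl.
by congr (_ ^+ _ *+ 2); lia.
Qed.

(** The triangular numbers C(m+1, 2) for m = 2k+1 and m = 2k+2 are the exponents of the two powers
    of order k+1 in the theta series. *)
Lemma theta2E (y : R) : y ^+ M = 0 -> theta2 y = theta y (y ^+ 3).
Proof.
move=> yM; have F0 m : (M <= m)%N -> y ^+ 'C(m.+1, 2) = 0.
  by move=> Mm; apply: (expr_nil yM); have := triangularE m; nia.
rewrite /theta2 -(sum_vanish (n := (2 * M).+1) F0); last by lia.
rewrite big_ord_recl /= expr0; congr (_ + _).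
rewrite (sum_double M (fun j => y ^+ 'C(j.+2, 2))); apply: eq_bigr => k _.
rewrite mulrDr -exprS -!exprM -!exprD.
have := triangularE k; have := triangularE (2 * k).+1; have := triangularE (2 * k).+2.
by move=> H1 H2 H3; congr (_ ^+ _ + _ ^+ _); nia.
Qed.

Lemma theta_prod (x y Q : R) : x * y = Q -> Q ^+ M = 0 ->
  theta x y = P x Q * P y Q * P (- Q) Q.
Proof. by move=> <- QM; rewrite jacobi_triple. Qed.

Lemma theta3_prod (y : R) : y ^+ M = 0 ->
  theta3 y = P y (y ^+ 2) ^+ 2 * P (- y ^+ 2) (y ^+ 2).
Proof. by move=> yM; rewrite theta3E (theta_prod (erefl (y * y))) -?expr2 ?nil_expr. Qed.

Lemma theta2_prod (y : R) : y ^+ M = 0 -> theta2 y = P y y ^+ 2 * P (- y) y.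
Proof.
move=> yM; rewrite theta2E // (theta_prod (esym (exprS y 3))) ?nil_expr //.
have y2M : (y ^+ 2) ^+ M = 0 by rewrite nil_expr.
have -> : P y (y ^+ 4) * P (y ^+ 3) (y ^+ 4) = P y (y ^+ 2).
  by rewrite (@poch_split _ _ y (y ^+ 2)) // -exprM -exprS.
have -> : P (- y ^+ 4) (y ^+ 4) = P (y ^+ 2) (y ^+ 2) * (P y y * P (- y) y).
  by rewrite poch_diff poch_diff -!exprM.
by rewrite mulrA (@poch_split _ _ y y) // -expr2; ring.
Qed.

Lemma theta2_sqr (y : R) : y ^+ M = 0 ->
  theta2 y ^+ 2 = theta3 y * theta2 (y ^+ 2).
Proof.
move=> yM; rewrite !theta2_prod ?nil_expr // theta3_prod // -!poch_diff.
by rewrite (@poch_split _ _ y y) // -expr2; ring.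
Qed.

(** Euler's identity between distinct and odd parts: after multiplication by the unit (y;
    y)_infinity the products recombine. *)
Lemma euler_odd_distinct (y : R) : y ^+ M = 0 -> P y y * P (- y) (y ^+ 2) = 1.
Proof.
move=> yM; have [v yv] := poch_unit yM.
rewrite -[LHS]mulr1 -{1}yv mulrA.
have -> : P y y * P (- y) (y ^+ 2) * P (- y) y
        = P (- y) (y ^+ 2) * P (- y * y) (y ^+ 2).
  by rewrite mulNr -expr2 -poch_diff; ring.
by rewrite -poch_split.
Qed.

(** Follows from the triple product, with Euler's identity at y split by exponents mod 3 and
    compared with the one at y^3. *)
Lemma theta_cubic (y : R) : y ^+ M = 0 ->
  theta y (y ^+ 2) * theta (- y) (- y ^+ 5) = theta2 (y ^+ 3) * theta3 (- y ^+ 3).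
Proof.
move=> yM; have y3M : (y ^+ 3) ^+ M = 0 by rewrite nil_expr.
have y2M : (y ^+ 2) ^+ M = 0 by rewrite nil_expr.
have y6M : (y ^+ 6) ^+ M = 0 by rewrite nil_expr.
have ny3M : (- y ^+ 3) ^+ M = 0 by rewrite exprNn y3M mulr0.
rewrite theta2_prod // theta3_prod // sqrrN.
rewrite (theta_prod (esym (exprS y 2))) // (theta_prod (Q := y ^+ 6)) //; last first.
  by rewrite mulrNN -exprS.
have E1 : P y y = P y (y ^+ 3) * P (y ^+ 2) (y ^+ 3) * P (y ^+ 3) (y ^+ 3).
  by rewrite {1}poch_split3 // -exprS -expr2.
have E2 : P (- y) (y ^+ 2) = P (- y) (y ^+ 6) * P (- y ^+ 3) (y ^+ 6) * P (- y ^+ 5) (y ^+ 6).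
  by rewrite {1}poch_split3 // -!exprM !mulNr -!exprS.
have e1 := euler_odd_distinct yM; have e3 := euler_odd_distinct y3M.
have E6 : P (- y ^+ 6) (y ^+ 6) = P (y ^+ 3) (y ^+ 3) * P (- y ^+ 3) (y ^+ 3).
  by rewrite poch_diff -!exprM.
rewrite -!exprM {}E6; rewrite E1 E2 in e1; rewrite -exprM in e3.
set a := P y _ in e1 *; set b := P (y ^+ 2) _ in e1 *; set c := P (- y) _ in e1 *.
set d := P (- y ^+ 5) _ in e1 *.
set l := P (y ^+ 3) (y ^+ 3) in e1 e3 *; set e := P (- y ^+ 3) (y ^+ 6) in e1 e3 *.
set E := P (- y ^+ 3) (y ^+ 3).
have e4 : a * b * c * d = 1 by rewrite -[LHS]mulr1 -[X in _ * X]e3 -[RHS]e1; ring.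
transitivity (l * E ^+ 2 * (a * b * c * d)); first by ring.
transitivity (l * E ^+ 2 * (l * e) ^+ 2); first by rewrite e3 e4; ring.
by ring.
Qed.

(** Odd squares are (2k+1)^2 = 8 C(k+1, 2) + 1. *)
Lemma theta3_dissect2 (y : R) : y ^+ M = 0 ->
  theta3 y = theta3 (y ^+ 4) + 2 * y * theta2 (y ^+ 8).
Proof.
move=> yM; rewrite /theta3 -(sum_vanish (F := fun k => y ^+ (k.+1 ^ 2)) (n := 2 * M)); last 2 first.
- by move=> j Mj; apply: (expr_nil yM); nia.
- by rewrite leq_pmull.
rewrite (sum_double M (fun k => y ^+ (k.+1 ^ 2))) big_split /= mulrDr [X in 1 + X]addrC addrA.
congr (1 + 2 * _ + _); first by apply: eq_bigr => k _; rewrite -exprM; congr (_ ^+ _); lia.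
rewrite -mulrA; congr (2 * _); rewrite mulr_sumr; apply: eq_bigr => k _.
by rewrite -exprM -exprS; have := triangularE k => H; congr (_ ^+ _); nia.
Qed.

(** The squares prime to 3 are 9k^2 + 6k + 1 and 9k^2 - 6k + 1. *)
Lemma theta3_dissect3 (y : R) : y ^+ M = 0 ->
  theta3 y = theta3 (y ^+ 9) + 2 * y * theta (y ^+ 3) (y ^+ 15).
Proof.
move=> yM; rewrite /theta3 -(sum_vanish (F := fun k => y ^+ (k.+1 ^ 2)) (n := 3 * M)); last 2 first.
- by move=> j Mj; apply: (expr_nil yM); nia.
- by rewrite leq_pmull.
rewrite (sum_triple M (fun k => y ^+ (k.+1 ^ 2))) big_split /= mulrDr [X in 1 + X]addrC addrA.
congr (1 + 2 * _ + _); first by apply: eq_bigr => k _; rewrite -exprM; congr (_ ^+ _); lia.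
rewrite -mulrA big_split /=; congr (2 * _).
have -> : \sum_(i < M) y ^+ ((3 * i).+1 ^ 2) = y * (1 + \sum_(i < M) y ^+ (9 * i.+1 ^ 2 + 6 * i.+1)).
  have F0 j : (M <= j)%N -> y ^+ ((3 * j).+1 ^ 2) = 0.
    by move=> Mj; apply: (expr_nil yM); nia.
  rewrite -(sum_vanish F0 (leqnSn M)) big_ord_recl /= expr1 mulrDr mulr1; congr (_ + _).
  by rewrite mulr_sumr; apply: eq_bigr => i _; rewrite -exprS; congr (_ ^+ _); rewrite /bump; lia.
have -> : \sum_(i < M) y ^+ ((3 * i).+2 ^ 2) = y * \sum_(i < M) y ^+ (9 * i ^ 2 + 12 * i + 3).
  by rewrite mulr_sumr; apply: eq_bigr => i _; rewrite -exprS; congr (_ ^+ _); lia.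
rewrite -mulrDr -addrA -big_split /theta /=; congr (_ * (_ + _)); apply: eq_bigr => k _.
rewrite -exprD -!exprM mulrDr -!exprD addrC.
by have := triangularE k => H; congr (_ ^+ _ + _ ^+ _); nia.
Qed.

(** Triangular numbers by m mod 3: m = 3k+1 gives 9 C(k+1, 2) + 1, the other two classes give
    multiples of 3. *)
Lemma theta2_dissect3 (y : R) : y ^+ M = 0 ->
  theta2 y = theta (y ^+ 3) (y ^+ 6) + y * theta2 (y ^+ 9).
Proof.
move=> yM; have F0 j : (M <= j)%N -> y ^+ 'C(j.+1, 2) = 0.
  by move=> Mj; apply: (expr_nil yM); have := triangularE j; nia.
rewrite /theta2 -(sum_vanish F0 (n := 3 * M)) ?leq_pmull //.
rewrite (sum_triple M (fun j => y ^+ 'C(j.+1, 2))) !big_split /= addrAC; congr (_ + _); last first.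
  rewrite mulr_sumr; apply: eq_bigr => k _; rewrite -exprM -exprS.
  have := triangularE k; have := triangularE (3 * k).+1 => H1 H2.
  by congr (_ ^+ _); nia.
have G0 j : (M <= j)%N -> y ^+ 'C((3 * j).+1, 2) = 0.
  by move=> Mj; apply: (expr_nil yM); have := triangularE (3 * j); nia.
rewrite -(sum_vanish G0 (leqnSn M)) big_ord_recl /= -addrA; congr (_ + _).
rewrite addrC -big_split; apply: eq_bigr => k _ /=; rewrite -exprD -!exprM mulrDr -!exprD.
have := triangularE k; have := triangularE (3 * k).+2; have := triangularE (3 * k.+1) => H1 H2 H3.
by rewrite /bump /= add1n; congr (_ ^+ _ + _ ^+ _); nia.
Qed.

End Theta.

Lemma mock_B_theta (R : comNzRingType) (q : R) (M : nat) : q ^+ M = 0 ->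
  (mock_B M q + mock_B M (- q)) * theta3 M (- q ^+ 2) = 2 * theta2 M (q ^+ 2) ^+ 2.
Proof.
move=> qM; have q2M : (q ^+ 2) ^+ M = 0 by rewrite nil_expr.
have nq2M : (- q ^+ 2) ^+ M = 0 by rewrite exprNn q2M mulr0.
rewrite theta2_prod // theta3_prod // sqrrN -(poch_diff M (q ^+ 2) (q ^+ 2)).
have := mock_B_even qM; rewrite (mulrC (poch M (- q) _)) (poch_diff M q (q ^+ 2)).
set Bs := _ + _; set a := poch M (- _) (_ ^+ _ ^+ _); set b := poch _ _ _; set c := poch _ _ _ => H.
transitivity (Bs * a ^+ 2 * (b * c)); first by ring.
by rewrite H; ring.
Qed.

(** * Transfer to coefficients *)

Lemma eval_rmorph (R : comNzRingType) (y : R) :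
  exists f : {rmorphism {poly int} -> R}, f 'X = y.
Proof.
exists (GRing.RMorphism.clone _ _ (horner_eval y \o map_poly (intmul 1)) _).
by rewrite /= map_polyX /horner_eval hornerX.
Qed.

Section Evaluation.
Context (R : comNzRingType) (f : {rmorphism {poly int} -> R}) (M : nat).
Local Notation y := (f 'X).
Hypothesis yM : y ^+ M = 0.

Lemma rmorph_polyE (p : {poly int}) : f p = \sum_(i < M) (p`_i)%:~R * y ^+ i.
Proof.
rewrite -{1}(poly_take_drop M p) rmorphD rmorphM rmorphXn /= yM mulr0 addr0.
rewrite /take_poly poly_def rmorph_sum; apply: eq_bigr => i _.
rewrite -mul_polyC rmorphM rmorphXn /=; congr (_ * _).
by rewrite -{1}[p`_i]intz !rmorph_int.
Qed.

Lemma eq_rmorph_poly (p1 p2 : {poly int}) :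
  (forall i, (i < M)%N -> p1`_i = p2`_i) -> f p1 = f p2.
Proof. by move=> E; rewrite (rmorph_polyE p1) (rmorph_polyE p2); apply: eq_bigr => i _; rewrite E. Qed.

Lemma mock_B_ge (N : nat) : (M <= N)%N -> mock_B N y = mock_B M y.
Proof.
move=> MN; rewrite /mock_B.
rewrite (@sum_vanish _ M N (fun n => y ^+ n * \prod_(j < n) (1 + y ^+ (2 * j + 1))
  * \prod_(j < n.+1) geos N (y ^+ (2 * j + 1)))) //.
  apply: eq_bigr => n _; congr (_ * _); apply: eq_bigr => j _.
  rewrite /geos (@sum_vanish _ M N (fun i => y ^+ (2 * j + 1) ^+ i)) // => i Mi.
  by rewrite -exprM (expr_nil yM) //; nia.
by move=> n Mn; rewrite (expr_nil yM) // !mul0r.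
Qed.

Lemma rmorph_Bterm (N : nat) :
  f (\sum_(m < N.+1) Bterm m N) = mock_B N.+1 y.
Proof.
rewrite rmorph_sum; apply: eq_bigr => m _; rewrite /Bterm !rmorphM rmorphXn !rmorph_prod /=.
congr (_ * _ * _); apply: eq_bigr => j _; first by rewrite rmorphD rmorph1 rmorphXn.
by rewrite /geom /geos rmorph_sum; apply: eq_bigr => i _; rewrite rmorphXn exprM.
Qed.

Lemma rmorph_theta3 (p : {poly int}) (N : nat) : f (theta3 N p) = theta3 N (f p).
Proof.
rewrite /theta3 rmorphD rmorph1 rmorphM rmorph_nat rmorph_sum.
by congr (_ + _ * _); apply: eq_bigr => k _; rewrite rmorphXn.
Qed.

Lemma rmorph_theta2 (p : {poly int}) (N : nat) : f (theta2 N p) = theta2 N (f p).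
Proof. by rewrite /theta2 rmorph_sum; apply: eq_bigr => k _; rewrite rmorphXn. Qed.

Lemma rmorph_theta (p1 p2 : {poly int}) (N : nat) :
  f (theta N p1 p2) = theta N (f p1) (f p2).
Proof.
rewrite /theta rmorphD rmorph1 rmorph_sum; congr (_ + _); apply: eq_bigr => k _.
by rewrite rmorphM rmorphXn rmorphD !rmorphXn rmorphM.
Qed.

End Evaluation.

Section Quotient.
Context (M : nat).
Hypothesis M0 : (0 < M)%N.

Local Notation h := ('X^M : {poly int}).

Lemma in_qpolyXn : in_qpoly h 'X ^+ M = 0.
Proof.
rewrite -rmorphXn /=; apply: val_inj => /=.
by rewrite mk_monic_Xn prednK // Pdiv.RingMonic.rmodpp // monicXn.
Qed.

(** Z[X]/(X^M) keeps all coefficients below M, so identities proved for a nilpotent q can be read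
    back over the integers. *)
Lemma coef_in_qpoly (p : {poly int}) (i : nat) : (i < M)%N ->
  (in_qpoly h p : {poly int})`_i = p`_i.
Proof.
move=> iM; have -> : in_qpoly h p = in_qpoly h (take_poly M p).
  by rewrite -{1}(poly_take_drop M p) rmorphD rmorphM rmorphXn in_qpolyXn mulr0 addr0.
rewrite in_qpoly_small ?mk_monic_Xn ?prednK // ?size_polyXn; last first.
  by rewrite ltnS size_take_poly.
by rewrite coef_take_poly iM.
Qed.

End Quotient.

(** The image consists of series in q^k; k = 2 serves the even part of B and k = 3 the
    3-dissection. *)
Lemma comp_in_qpoly (h : {poly int}) (k : nat) :
  exists f : {rmorphism {poly int} -> {poly %/ h}},
    forall p, f p = in_qpoly h (p \Po 'X^k).
Proof. by exists (GRing.RMorphism.clone _ _ (in_qpoly h \o comp_poly 'X^k) _). Qed.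

Lemma coef_Bterm_sum (N n : nat) : (n <= N)%N ->
  (\sum_(m < N.+1) Bterm m N)`_n = b n.
Proof.
move=> nN; rewrite /b -(coef_in_qpoly (ltn0Sn n) _ (ltnSn n)).
rewrite -[RHS](coef_in_qpoly (ltn0Sn n) _ (ltnSn n)).
have XM := in_qpolyXn (ltn0Sn n).
by rewrite !rmorph_Bterm (mock_B_ge (M := n.+1)).
Qed.

Lemma mock_B_series (R : comNzRingType) (y : R) (M : nat) : y ^+ M = 0 ->
  mock_B M y = \sum_(n < M) (b n)%:~R * y ^+ n.
Proof.
case: M => [|M] yM; first by rewrite /mock_B !big_ord0.
have [f fX] := eval_rmorph y; rewrite -fX -rmorph_Bterm (@rmorph_polyE _ _ M.+1) ?fX //.
by apply: eq_bigr => n _; rewrite coef_Bterm_sum // -ltnS.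
Qed.

(** [mock_B_theta] is used modulo q^(2K) with X sent to q^2, so coefficient i is read off at q^(2i);
    the common factor 2 is cancelled over the integers. *)
Lemma mock_B_even_theta (K : nat) (i : nat) : (i < K)%N ->
  ((\poly_(m < K) b (2 * m)) * theta3 (2 * K) (- 'X))`_i = (theta2 (2 * K) 'X ^+ 2)`_i.
Proof.
move=> iK; pose M := (2 * K)%N.
have M0 : (0 < M)%N by rewrite /M; lia.
pose q := in_qpoly 'X^M 'X : {poly %/ ('X^M : {poly int})}.
have qM : q ^+ M = 0 by apply: in_qpolyXn.
have := mock_B_theta qM.
have nqM : (- q) ^+ M = 0 by rewrite exprNn qM mulr0.
have [f fE] := comp_in_qpoly 'X^M 2.
have fX : f 'X = q ^+ 2 by rewrite fE comp_polyX rmorphXn.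
have fM : (f 'X) ^+ K = 0 by rewrite fX -exprM.
have -> : mock_B M q + mock_B M (- q) = 2 * f (\poly_(m < K) b (2 * m)).
  rewrite !mock_B_series // -big_split (rmorph_polyE fM) /=.
  rewrite (sum_double K (fun n => (b n)%:~R * q ^+ n + (b n)%:~R * (- q) ^+ n)) mulr_sumr.
  apply: eq_bigr => m _; rewrite coef_poly ltn_ord fX ![_ ^+ (2 * m).+1]exprS.
  by rewrite !(exprM _ 2) sqrrN; ring.
rewrite -fX -[X in theta3 _ X]rmorphN -rmorph_theta3 -rmorph_theta2 -rmorphXn -mulrA -rmorphM.
set p1 := _ * theta3 _ _; set p2 := theta2 _ _ ^+ 2.
rewrite -[2](rmorph_nat f) -!rmorphM !fE => E.
have i2 : (2 * i < M)%N by rewrite /M; lia.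
have {E} : (2 * p1)`_i = (2 * p2)`_i.
  have C (p : {poly int}) : p`_i = (p \Po 'X^2)`_(2 * i).
    by rewrite coef_comp_poly_Xn // dvdn_mulr // mulKn.
  by rewrite !C -(coef_in_qpoly M0 _ i2) E coef_in_qpoly.
by rewrite !mulr_natl !coefMn => /(@pmulrnI int 2 isT).
Qed.

(** * The coefficients b(2m) modulo 9 and modulo 8 *)

Lemma theta3_0 (R : comNzRingType) (M : nat) : theta3 M (0 : R) = 1.
Proof.
by rewrite /theta3 big1 ?mulr0 ?addr0 // => k _; rewrite expr0n expn_eq0.
Qed.

Lemma theta3_unit (R : comNzRingType) (M : nat) (y : R) : y ^+ M = 0 ->
  exists v, theta3 M y * v = 1.
Proof.
move=> yM; pose s := \sum_(k < M) y ^+ (k.+1 ^ 2 - 1).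
exists (geos M (y * (- 2 * s))).
rewrite -[RHS](geosP (y := y * (- 2 * s)) (M := M)) ?exprMn ?yM ?mul0r //.
congr (_ * _); rewrite /theta3.
have -> : \sum_(k < M) y ^+ (k.+1 ^ 2) = y * s; last by ring.
by rewrite mulr_sumr; apply: eq_bigr => k _; rewrite -exprS; congr (_ ^+ _); lia.
Qed.

Lemma even_part_theta (K : nat) (f : {rmorphism {poly int} -> {poly %/ ('X^K : {poly int})}}) :
  f 'X ^+ K = 0 ->
  f (\poly_(m < K) b (2 * m)) * theta3 (2 * K) (- f 'X) = theta2 (2 * K) (f 'X) ^+ 2.
Proof.
move=> fK; rewrite -rmorphN -rmorph_theta3 -rmorphM -rmorph_theta2 -rmorphXn.
by apply: (eq_rmorph_poly fK) => i iK; rewrite mock_B_even_theta.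
Qed.

(** Write phi(-q) = a - 2qw and psi(q) = A + qP with a, w, A, P series in q^3. Then 1/phi(-q) = (a^2
    + 2qaw + 4q^2 w^2)/(a^3 - 8q^3 w^3), and the part of psi(q)^2/phi(-q) with exponents 2 mod 3 has
    numerator q^2 (4(Aw)^2 + 4(Aw)(Pa) + (Pa)^2), which is 9q^2 (Pa)^2 because Aw = Pa by
    [theta_cubic]. *)
Lemma b_mod9 (m : nat) : (m %% 3 = 2)%N -> (9 %| b (2 * m))%Z.
Proof.
move=> m3; pose K := m.+1; pose M := (2 * K)%N; pose h : {poly int} := 'X^K.
pose f : {rmorphism {poly int} -> {poly %/ h}} := in_qpoly h; pose q := f 'X.
have qK : q ^+ K = 0 by apply: in_qpolyXn.
have qM : q ^+ M = 0 by apply: (expr_nil qK); rewrite /M; lia.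
have nqM : (- q) ^+ M = 0 by rewrite exprNn qM mulr0.
have := even_part_theta qK; rewrite -/q -/M.
have [g gE] := comp_in_qpoly h 3.
have fg p : f (p \Po 'X^3) = g p by rewrite gE.
have gX : g 'X = q ^+ 3 by rewrite gE comp_polyX rmorphXn.
rewrite (theta3_dissect3 nqM) (theta2_dissect3 qM).
have := theta_cubic (nil_expr qM (isT : 0 < 3)%N); rewrite -!exprM.
have oddN k : odd k -> (- q) ^+ k = - q ^+ k by move=> ok; rewrite exprNn -signr_odd ok mulN1r.
rewrite !oddN //.
pose a := theta3 M (- 'X^3 : {poly int}); pose w := theta M (- 'X : {poly int}) (- 'X^5).
pose A := theta M ('X : {poly int}) 'X^2; pose P := theta2 M ('X^3 : {poly int}).
have -> : theta3 M (- q ^+ 9) = g a by rewrite rmorph_theta3 rmorphN rmorphXn gX -exprM.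
have -> : theta M (- q ^+ 3) (- q ^+ 15) = g w.
  by rewrite rmorph_theta !rmorphN rmorphXn gX -exprM.
have -> : theta M (q ^+ 3) (q ^+ 6) = g A by rewrite rmorph_theta rmorphXn gX -exprM.
have -> : theta2 M (q ^+ 9) = g P by rewrite rmorph_theta2 rmorphXn gX -exprM.
move=> H1 H2.
(* The denominator has constant term 1, so its inverse is a geometric series, again in q^3. *)
have [z zE] : exists z, a ^+ 3 - 8 * 'X * w ^+ 3 = 1 - 'X * z.
  have a0 : a.[0] = 1.
    rewrite -[LHS]/(horner_eval 0 a) (rmorph_theta3 (horner_eval 0)).
    by rewrite rmorphN rmorphXn /= /horner_eval hornerX expr0n oppr0 theta3_0.
  have : root (1 - (a ^+ 3 - 8 * 'X * w ^+ 3)) 0.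
    rewrite rootE hornerD hornerN hornerD hornerN horner_exp a0 [8 * _]mulrC -mulrA.
    by rewrite hornerM hornerX mul0r subr0 expr1n hornerC subrr.
  by case/factor_theorem => z zE; exists z; rewrite -[LHS](subKr 1) zE subr0 mulrC.
pose v := geos M ('X * z).
have gv : g (a ^+ 3 - 8 * 'X * w ^+ 3) * geos M (g ('X * z)) = 1.
  by rewrite zE rmorphB rmorph1 geosP // rmorphM gX exprMn -exprM mulnC exprM qM expr0n mul0r.
have gvE : geos M (g ('X * z)) = g (geos M ('X * z)).
  by rewrite /geos rmorph_sum; apply: eq_bigr => i _; rewrite rmorphXn.
rewrite {}gvE in gv; set V := geos _ _ in gv.
clearbody a w A P V.
(* The numerator sorted by exponents mod 3, with X standing for q^3; the factor 9 of the third part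
   is kept outside [X2]. *)
pose X0 := A ^+ 2 * a ^+ 2 + 'X * (8 * A * P * w ^+ 2 + 2 * P ^+ 2 * a * w).
pose X1 := 2 * A ^+ 2 * a * w + 2 * A * P * a ^+ 2 + 4 * 'X * P ^+ 2 * w ^+ 2.
pose X2 := P ^+ 2 * a ^+ 2.
pose p := (X0 * V) \Po 'X^3 + 'X * ((X1 * V) \Po 'X^3) + 'X^2 * ((9 * X2 * V) \Po 'X^3).
have E : f (\poly_(m < K) b (2 * m)) = f p.
  rewrite /p rmorphD [X in _ = X + _]rmorphD [f ('X * _)]rmorphM [f ('X^2 * _)]rmorphM.
  rewrite [f 'X^2]rmorphXn -/q !fg.
  move: gv; rewrite /X0 /X1 /X2.
  rewrite !(rmorph_nat, rmorphXn, rmorphD, rmorphN, rmorphM, gX).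
  move: (g a) (g w) (g A) (g P) (g V) H1 H2 => a' w' A' P' V' H1 H2 gv.
  have Et t : t = t * ((a' ^+ 3 - 8 * q ^+ 3 * w' ^+ 3) * V') by rewrite gv mulr1.
  rewrite [LHS]Et.
  transitivity (f (\poly_(m0 < K) b (2 * m0)) * (a' + 2 * - q * w')
     * (a' ^+ 2 + 2 * q * a' * w' + 4 * q ^+ 2 * w' ^+ 2) * V'); first by ring.
  rewrite H2.
  transitivity ((A' ^+ 2 * a' ^+ 2 + q ^+ 3 * (8 * A' * P' * w' ^+ 2 + 2 * P' ^+ 2 * a' * w')
     + q * (2 * A' ^+ 2 * a' * w' + 2 * A' * P' * a' ^+ 2 + 4 * q ^+ 3 * P' ^+ 2 * w' ^+ 2)
     + q ^+ 2 * (4 * (A' * w') ^+ 2 + 4 * (A' * w') * (P' * a') + (P' * a') ^+ 2)) * V').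
    by ring.
  by rewrite H1; ring.
have mK : (m < K)%N by [].
have {E} : (\poly_(m < K) b (2 * m))`_m = p`_m.
  by rewrite -(coef_in_qpoly (ltn0Sn m) _ mK) -/h -/f E coef_in_qpoly.
rewrite coef_poly mK => ->; rewrite /p !coefD coefXM coefXnM.
rewrite !coef_comp_poly_Xn //.
have -> : (3 %| m)%N = false by lia.
have -> : (3 %| m.-1)%N = false by lia.
have -> : (m == 0)%N = false by lia.
have -> : (m < 2)%N = false by lia.
have -> : (3 %| m - 2)%N by lia.
rewrite !add0r -mulrA mulr_natl coefMn.
by set t := (X2 * V)`__; apply/dvdzP; exists t; rewrite mulr_natr.
Qed.

(** With E = phi(q^4), which is 1 mod 2, phi(q)/phi(-q) = (E + 2q psi(q^8))/(E - 2q psi(q^8)) is 1 +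
    4q psi(q^8) mod 8. An exponent k(k+1) of psi(q^2) equal to m would make 4m + 1 a square, so only
    4q psi(q^2) psi(q^8) contributes at q^m. *)
Lemma b_mod8 (m : nat) : (forall k : nat, k ^ 2 != 4 * m + 1)%N ->
  exists t : int, b (2 * m)
    = 4 * #|[set x : 'I_m.+1 * 'I_m.+1 |
              (2 * x.1 + 1) ^ 2 + 4 * (2 * x.2 + 1) ^ 2 == 4 * m + 1]%N|%:Z + 8 * t.
Proof.
move=> nsq; pose K := m.+1; pose M := (2 * K)%N; pose h : {poly int} := 'X^K.
pose f : {rmorphism {poly int} -> {poly %/ h}} := in_qpoly h; pose q := f 'X.
have qK : q ^+ K = 0 by apply: in_qpolyXn.
have qM : q ^+ M = 0 by apply: (expr_nil qK); rewrite /M; lia.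
have nqM : (- q) ^+ M = 0 by rewrite exprNn qM mulr0.
have := even_part_theta qK; rewrite -/q -/M theta2_sqr //.
rewrite [theta3 M q]theta3_dissect2 // => H.
have [v vE] := theta3_unit nqM.
have E4 : theta3 M (q ^+ 4) = 1 + 2 * \sum_(k < M) (q ^+ 4) ^+ (k.+1 ^ 2) by [].
have evN k : ~~ odd k -> (- q) ^+ k = q ^+ k.
  by move=> ok; rewrite exprNn -signr_odd (negbTE ok) mul1r.
have := theta3_dissect2 nqM; rewrite !evN // => D.
pose psi2 := theta2 K ('X^2 : {poly int}); pose psi8 := theta2 K ('X^8 : {poly int}).
have st k : (0 < k)%N -> theta2 M (q ^+ k) = f (theta2 K 'X^k).
  move=> k0; rewrite rmorph_theta2 rmorphXn /theta2 -/q.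
  apply: (sum_vanish (F := fun j => (q ^+ k) ^+ 'C(j.+1, 2))); last by rewrite /M; lia.
  by move=> j Kj; apply: (expr_nil (nil_expr qK k0)); have := triangularE j; nia.
rewrite !st // -/psi2 -/psi8 in H D.
have [z zE] : exists z, f (\poly_(m0 < K) b (2 * m0)) = f (psi2 * (1 + 4 * 'X * psi8)) + 8 * z.
  move: H D; rewrite !(rmorph_nat, rmorphD, rmorph1, rmorphM, rmorphXn) -/q E4.
  set e := \sum_(k < M) _; move: (f psi2) (f psi8) => O2 O8 H D.
  (* For E = 1 + 2e, (E + 2q O8) - (1 + 4q O8)(E - 2q O8) = 8 (q^2 O8^2 - q O8 e); [v] inverts
     phi(-q). *)
  exists (O2 * (q ^+ 2 * O8 ^+ 2 - q * O8 * e) * v).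
  have Et t : t = t * theta3 M (- q) * v by rewrite -mulrA vE mulr1.
  by rewrite [LHS]Et H [X in _ = X + _]Et D; ring.
pose p := psi2 * (1 + 4 * 'X * psi8) + 8 * (z : {poly int}).
have fz : f (z : {poly int}) = z.
  by apply: val_inj; rewrite /= Pdiv.CommonRing.rmodp_small // size_mk_monic.
have mK : (m < K)%N by [].
have {zE} : (\poly_(m < K) b (2 * m))`_m = p`_m.
  rewrite -(coef_in_qpoly (ltn0Sn m) _ mK) -/h -/f zE -{1}fz -[8](rmorph_nat f).
  by rewrite -rmorphM -rmorphD coef_in_qpoly.
rewrite coef_poly mK => ->; exists (z : {poly int})`_m.
have coef_nat (n : nat) (t : {poly int}) : (n%:R * t)`_m = n%:R * t`_m.
  by rewrite !mulr_natl coefMn.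
have -> : p = psi2 + 4 * ('X * (psi2 * psi8)) + 8 * (z : {poly int}) by rewrite /p; ring.
rewrite !coefD !coef_nat; congr (_ + _).
have T2 k l : (2 * 'C(k.+1, 2) = l)%N -> (l = k * k.+1)%N by rewrite triangularE.
have -> : psi2`_m = 0.
  rewrite coef_sum big1 // => k _; rewrite -exprM coefXn.
  case: eqP => // /esym/T2 mE; case/negP: (nsq (2 * k + 1)%N); lia.
rewrite add0r; congr (_ * _).
rewrite /psi2 /psi8 /theta2 big_distrlr /= mulr_sumr coef_sum.
under eq_bigr do rewrite mulr_sumr coef_sum.
rewrite pair_big /= -sum1_card -natz natr_sum.
rewrite [RHS]big_mkcond /=; apply: eq_bigr => -[k l] _ /=.
rewrite inE /= -!exprM -exprD -exprS coefXn.
have := triangularE k; have := triangularE l => H1 H2.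
have -> : (m == (2 * 'C(k.+1, 2) + 8 * 'C(l.+1, 2)).+1)%N
  = ((2 * k + 1) ^ 2 + 4 * (2 * l + 1) ^ 2 == 4 * m + 1)%N by lia.
by case: ifP.
Qed.

(** * Zagier's involution *)

Local Open Scope nat_scope.

Lemma even_card_involution (T : finType) (A : {set T}) (f : T -> T) :
  (forall x, x \in A -> [/\ f x \in A, f (f x) = x & f x != x]) -> ~~ odd #|A|.
Proof.
have [n] := ubnP #|A|; elim: n A => // n IHn A leAn fA.
have [-> | [x xA]] := set_0Vmem A; first by rewrite cards0.
have [fxA ffx nfx] := fA x xA.
have fxA' : f x \in A :\ x by rewrite !inE nfx.
rewrite (cardsD1 x) xA (cardsD1 (f x)) fxA' /= negbK; apply: IHn.
  by move: leAn; rewrite (cardsD1 x) xA (cardsD1 (f x)) fxA'; lia.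
move=> y; rewrite !inE => /and3P[yfx yx yA]; have [fyA ffy nfy] := fA y yA.
rewrite fyA ffy nfy andbT; split=> //; apply/andP; split; apply/eqP => E.
  by rewrite -ffy E ffx eqxx in yx.
by rewrite -ffy E eqxx in yfx.
Qed.

Lemma odd_card_involution (T : finType) (A : {set T}) (f : T -> T) :
  (forall x, x \in A -> f x \in A /\ f (f x) = x) ->
  odd #|A| = odd #|[set x in A | f x == x]|.
Proof.
move=> fA; rewrite -(cardsID [set x in A | f x == x] A) oddD.
rewrite [odd #|A :\: _|](negbTE (even_card_involution (f := f) _)) ?addbF.
  by congr (odd _); apply: eq_card => x; rewrite !inE andbA andbb.
move=> x; rewrite !inE => /andP[nfx xA]; have [fxA ffx] := fA x xA.
by move: nfx; rewrite fxA xA /= ffx => nfx; rewrite nfx eq_sym nfx.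
Qed.

Lemma card_bij_in (T U : finType) (A : {set T}) (B : {set U}) (f : T -> U) (g : U -> T) :
  (forall x, x \in A -> f x \in B /\ g (f x) = x) ->
  (forall y, y \in B -> g y \in A /\ f (g y) = y) -> #|A| = #|B|.
Proof.
move=> fA gB; rewrite -(card_in_imset (f := f) (D := A)); last first.
  by move=> x y /fA[_ {2}<-] /fA[_ {2}<-] ->.
apply: eq_card => y; apply/imsetP/idP => [[x /fA[fxB _] -> //]|/gB[gyA yE]].
by exists (g y).
Qed.

Lemma zagier_eq1 (x y z : nat) : x + z < y ->
  (x + 2 * z) ^ 2 + 4 * z * (y - x - z) = x ^ 2 + 4 * y * z.
Proof.
move=> c; have [d ->] : exists d, y = x + z + d by exists (y - (x + z)); lia.
have -> : x + z + d - x - z = d by lia.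
by lia.
Qed.

Lemma zagier_eq2 (x y z : nat) : 2 * y < x ->
  (x - 2 * y) ^ 2 + 4 * (x - y + z) * y = x ^ 2 + 4 * y * z.
Proof.
move=> c; have [d ->] : exists d, x = 2 * y + d by exists (x - 2 * y); lia.
rewrite addKn; have -> : 2 * y + d - y = y + d by lia.
by lia.
Qed.

Lemma zagier_eq3 (x y z : nat) : y <= x + z -> x <= 2 * y ->
  (2 * y - x) ^ 2 + 4 * y * (x + z - y) = x ^ 2 + 4 * y * z.
Proof.
move=> c1 c2; have [d dE] : exists d, 2 * y = x + d by exists (2 * y - x); lia.
have [e eE] : exists e, x + z = y + e by exists (x + z - y); lia.
rewrite dE eE !addKn.
have H1 := congr1 (muln d) dE; have H2 := congr1 (muln x) dE.
have H3 := congr1 (muln y) dE; have H4 := congr1 (muln y) eE.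
by lia.
Qed.

Section Zagier.
Context (N : nat).
Hypothesis N4 : N %% 4 = 1.
Hypothesis Nsq : forall k, k ^ 2 <> N.

Local Notation I := 'I_N.+1.
Local Notation T := (I * I * I)%type.

Definition zagier_set : {set T} := [set t : T | t.1.1 ^ 2 + 4 * t.1.2 * t.2 == N].

Let triple (x y z : nat) : T := (inord x, inord y, inord z).

(** As N is not a square, y and z are positive; hence x, y, z are at most N and [inord] keeps their
    values. *)
Lemma zagier_tripleP (x y z : nat) : x ^ 2 + 4 * y * z = N ->
  [/\ triple x y z \in zagier_set, (triple x y z).1.1 = x :> nat,
      (triple x y z).1.2 = y :> nat & (triple x y z).2 = z :> nat].
Proof.
move=> E.
have yz : 0 < y * z by rewrite lt0n; apply/eqP => yz0; case: (Nsq (k := x)); nia.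
have [y0 z0] : 0 < y /\ 0 < z by apply/andP; rewrite -muln_gt0.
have yy : y <= y * z by rewrite leq_pmulr.
have zz : z <= y * z by rewrite leq_pmull.
have xx : x <= x ^ 2 by rewrite -mulnn; case: (x) => // k; rewrite leq_pmull.
have [xN yN zN] : [/\ x < N.+1, y < N.+1 & z < N.+1] by split; lia.
by rewrite inE /= !inordK // E eqxx.
Qed.

Lemma zagierP (t : T) : t \in zagier_set ->
  [/\ t.1.1 ^ 2 + 4 * t.1.2 * t.2 = N, 0 < t.1.1, 0 < t.1.2, 0 < t.2 & odd t.1.1].
Proof.
case: t => [[x y] z]; rewrite inE /= => /eqP E.
have x1 : odd x.
  apply/negPn/negP => xe; have xh := even_halfK xe; rewrite -mul2n in xh.
  have NE : x ^ 2 = 4 * x./2 ^ 2 by rewrite -{1}xh expnMn.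
  by have := N4; lia.
have yz : 0 < y * z by rewrite lt0n; apply/eqP => yz0; case: (Nsq (k := x)); nia.
by move: yz; rewrite muln_gt0 => /andP[-> ->]; rewrite odd_gt0.
Qed.

Lemma zagier_triple_eq (t : T) (x y z : nat) : t.1.1 = x :> nat -> t.1.2 = y :> nat -> t.2 = z :> nat ->
  triple x y z = t.
Proof. by case: t => [[? ?] ?] /= <- <- <-; rewrite /triple !inord_val. Qed.

Definition zagier_map (t : T) : T :=
  let: (x, y, z) := (val t.1.1, val t.1.2, val t.2) in
  if x + z < y then triple (x + 2 * z) z (y - x - z)
  else if 2 * y < x then triple (x - 2 * y) (x - y + z) y
  else triple (2 * y - x) y (x + z - y).

Lemma zagier_mapK (t : T) : t \in zagier_set ->
  zagier_map t \in zagier_set /\ zagier_map (zagier_map t) = t.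
Proof.
move=> /zagierP[]; case: t => [[x y] z] /= E x0 y0 z0 xo.
(* The boundaries between the branches are not met: y = x + z would give N = (y + z)^2, and x = 2y
   an even x. *)
have ny : nat_of_ord y <> x + z by move=> yE; case: (Nsq (k := y + z)); apply: etrans E; rewrite yE; lia.
have nx : nat_of_ord x <> 2 * y by move=> xE; move: xo; rewrite xE oddM.
rewrite [zagier_map (x, y, z)]/zagier_map /=.
have [c1|c1] := ltnP (x + z) y.
  have [] := @zagier_tripleP (x + 2 * z) z (y - x - z); first by rewrite zagier_eq1.
  case: (triple _ _ _) => [[x' y'] z'] -> t1 t2 t3; split=> //.
  rewrite /zagier_map /= t1 t2 t3 ifF ?ifT; [| lia ..].
  by apply: zagier_triple_eq => /=; lia.
have [c2|c2] := ltnP (2 * y) x.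
  have [] := @zagier_tripleP (x - 2 * y) (x - y + z) y; first by rewrite zagier_eq2.
  case: (triple _ _ _) => [[x' y'] z'] -> t1 t2 t3; split=> //.
  rewrite /zagier_map /= t1 t2 t3 ifT; [| lia ..].
  by apply: zagier_triple_eq => /=; lia.
have [] := @zagier_tripleP (2 * y - x) y (x + z - y); first by rewrite zagier_eq3.
case: (triple _ _ _) => [[x' y'] z'] -> t1 t2 t3; split=> //.
rewrite /zagier_map /= t1 t2 t3 !ifF; [| lia ..].
by apply: zagier_triple_eq => /=; lia.
Qed.

(** The first two branches change x by 2z or 2y and fix nothing; in the third, 2y - x = x means x =
    y. *)
Lemma zagier_fixed (t : T) : t \in zagier_set ->
  (zagier_map t == t) = (t.1.1 == t.1.2).
Proof.
move=> /zagierP[]; case: t => [[x y] z] /= E x0 y0 z0 xo.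
have nx : nat_of_ord x <> 2 * y by move=> xE; move: xo; rewrite xE oddM.
apply/eqP/eqP => [|xy]; last first.
  by rewrite /zagier_map /= !ifF; [apply: zagier_triple_eq | |]; rewrite /= ?xy; lia.
rewrite /zagier_map /=; have [c1|c1] := ltnP (x + z) y.
  have [] := @zagier_tripleP (x + 2 * z) z (y - x - z); first by rewrite zagier_eq1.
  by move=> _ t1 _ _ tE; move: t1; rewrite tE /=; lia.
have [c2|c2] := ltnP (2 * y) x.
  have [] := @zagier_tripleP (x - 2 * y) (x - y + z) y; first by rewrite zagier_eq2.
  by move=> _ t1 _ _ tE; move: t1; rewrite tE /=; lia.
have [] := @zagier_tripleP (2 * y - x) y (x + z - y); first by rewrite zagier_eq3.
by move=> _ t1 _ _ tE; move: t1; rewrite tE /= => t1; apply: val_inj => /=; lia.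
Qed.

(** Swapping y and z is a second involution of the same set, so both fixed-point counts have the
    parity of its cardinal. *)
Lemma odd_zagier :
  odd #|[set t in zagier_set | t.1.2 == t.2]| = odd #|[set t in zagier_set | t.1.1 == t.1.2]|.
Proof.
pose sw (t : T) : T := (t.1.1, t.2, t.1.2).
have swS t : t \in zagier_set -> sw t \in zagier_set /\ sw (sw t) = t.
  case: t => [[x y] z]; rewrite !inE /= => E; split=> //.
  by rewrite mulnAC.
transitivity (odd #|[set t in zagier_set | sw t == t]|).
  congr (odd _); apply: eq_card => -[[x y] z]; rewrite !inE; congr (_ && _).
  by apply/eqP/eqP => [/= -> //|[]].
rewrite -(odd_card_involution swS) (odd_card_involution zagier_mapK).
congr (odd _); apply: eq_card => t; rewrite [LHS]inE [RHS]inE.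
by case tS: (t \in zagier_set) => //=; rewrite zagier_fixed.
Qed.

(** For x = y the equation reads N = x (x + 4z), so x is a divisor below the square root and
    determines z. *)
Lemma card_zagier_diag :
  #|[set t in zagier_set | t.1.1 == t.1.2]| = #|[set d : I | (d %| N) && (d ^ 2 < N)]|.
Proof.
apply: (card_bij_in (f := fun t : T => t.1.1)
   (g := fun d : I => triple d d ((N %/ d - d) %/ 4))) => [t|d].
  move=> tA; have /andP[tS /eqP] : (t \in zagier_set) && (t.1.1 == t.1.2).
    by move: tA; rewrite in_set.
  have [] := zagierP tS.
  case: t tA tS => [[x y] z] /= _ _ E x0 y0 z0 xo xy.
  have NE : N = (x + 4 * z) * x by apply: etrans (esym E) _; rewrite -xy; lia.
  split; first by rewrite inE; apply/andP; split; [apply/dvdnP; exists (x + 4 * z) | nia].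
  have -> : N %/ x = x + 4 * z by rewrite [X in X %/ _]NE mulnK.
  by apply: zagier_triple_eq; rewrite /= ?xy //; lia.
move=> dA; have /andP[/dvdnP[w wE] dN] : (d %| N) && (d ^ 2 < N) by move: dA; rewrite in_set.
have dw : d < w by nia.
have d0 : 0 < d by case: (posnP d) => // d0; move: N4; nia.
(* A product d w that is 1 mod 4 forces d = w mod 4. *)
have [z zE] : exists z, w = d + 4 * z.
  exists ((w - d) %/ 4); suff : w %% 4 = d %% 4 by lia.
  have : (w %% 4) * (d %% 4) %% 4 = 1 by rewrite modnMm -wE.
  have := ltn_pmod w (isT : 0 < 4); have := ltn_pmod d (isT : 0 < 4).
  by case: (w %% 4) (d %% 4) => [|[|[|[|?]]]] [|[|[|[|?]]]].
have -> : (N %/ d - d) %/ 4 = z by rewrite [X in X %/ d]wE mulnK // zE; lia.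
have [] := @zagier_tripleP d d z; first by apply: etrans (esym wE); rewrite zE; lia.
case: (triple _ _ _) => [[x' y'] z'] tS t1 t2 t3; split; last exact: val_inj.
by rewrite inE tS /=; apply/eqP/val_inj; rewrite /= t1 t2.
Qed.

End Zagier.

(** * Divisors below the square root and the number of divisors *)

Definition small_divisors (N : nat) : nat := #|[set d : 'I_N.+1 | (d %| N) && (d ^ 2 < N)]|.

(** The map d -> N/d exchanges the divisors on the two sides of the square root. *)
Lemma size_divisors_nonsquare (N : nat) : 0 < N -> (forall k, k ^ 2 <> N) ->
  size (divisors N) = 2 * small_divisors N.
Proof.
move=> N0 Nsq.
have sE : size (divisors N) = #|[set d : 'I_N.+1 | d %| N]|.
  rewrite cardE -(size_map val); apply/perm_size/uniq_perm.
  - exact: divisors_uniq.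
  - by rewrite (map_inj_uniq val_inj) enum_uniq.
  move=> d; rewrite -dvdn_divisors //; apply/idP/mapP => [dN|[e]].
    have dl : d < N.+1 by rewrite ltnS dvdn_leq.
    by exists (Ordinal dl); rewrite // mem_enum inE.
  by rewrite mem_enum inE => eN ->.
rewrite sE -(cardsID [set d : 'I_N.+1 | d ^ 2 < N]) mul2n -addnn; congr (_ + _).
  by apply: eq_card => d; rewrite !inE.
have codiv (d : nat) : d %| N -> exists w, [/\ N = w * d, N %/ d = w, N %/ w = d, w %| N & w < N.+1].
  move=> dN; exists (N %/ d); have wN : N %/ d %| N by apply/dvdnP; exists d; rewrite mulnC divnK.
  have d0 := dvdn_gt0 N0 dN.
  have w0 : 0 < N %/ d by rewrite divn_gt0 // dvdn_leq.
  by split; rewrite ?divnK ?ltnS ?leq_div // -{1}(divnK dN) mulKn.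
have codivI (w : nat) : w < N.+1 -> val (inord w : 'I_N.+1) = w by move=> ?; rewrite /= inordK.
apply: (card_bij_in (f := fun d : 'I_N.+1 => inord (N %/ d)) (g := fun d : 'I_N.+1 => inord (N %/ d))) => d.
  rewrite !inE => /andP[dS dN]; have [w [NE wE dE wN wl]] := codiv _ dN.
  have /= cE := codivI _ wl.
  split; last by apply: val_inj; rewrite /= wE cE dE codivI.
  rewrite wE cE wN /=; move: dS; rewrite -leqNgt; have := Nsq d; have := Nsq w; nia.
rewrite !inE => /andP[dN dS]; have [w [NE wE dE wN wl]] := codiv _ dN.
have /= cE := codivI _ wl.
split; last by apply: val_inj; rewrite /= wE cE dE codivI.
by rewrite wE cE wN andbT -leqNgt; nia.
Qed.

Lemma size_divisors_pfactor (p e m : nat) : prime p -> 0 < m -> ~~ (p %| m) ->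
  size (divisors (p ^ e * m)) = e.+1 * size (divisors m).
Proof.
move=> pp m0 pm; have p0 := prime_gt0 pp.
have N0 : 0 < p ^ e * m by rewrite muln_gt0 expn_gt0 p0.
have cop i d : d %| m -> coprime (p ^ i) d.
  by move=> dm; apply: coprimeXl; rewrite prime_coprime //; apply: contra pm => /dvdn_trans; apply.
rewrite -[e.+1](size_iota 0) -(size_allpairs (fun i d => p ^ i * d)).
apply/perm_size/uniq_perm; first exact: divisors_uniq.
  apply: allpairs_uniq; rewrite ?iota_uniq ?divisors_uniq // => u v.
  case/allpairsP => -[i1 d1] [_ dm ->]; case/allpairsP => -[j1 c1] [_ cm ->].
  rewrite /= in dm cm *.
  rewrite -dvdn_divisors // in dm; rewrite -dvdn_divisors // in cm.
  move=> E; have dc a b : a %| m -> logn p (p ^ b * a) = b.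
    move=> am; rewrite lognM ?expn_gt0 ?p0 ?(dvdn_gt0 m0 am) // pfactorK //.
    by rewrite logn_coprime ?addn0 //; have := cop 1 a am; rewrite expn1.
  have ij : i1 = j1 by rewrite -(dc d1 i1 dm) E dc.
  by move: E; rewrite ij => /eqP; rewrite eqn_pmul2l ?expn_gt0 ?p0 // => /eqP ->.
move=> d; rewrite -dvdn_divisors //; apply/idP/allpairsP => [dN|[[i c] [ie cm ->]]]; last first.
  rewrite [fst _]/= [snd _]/= in ie cm *.
  rewrite -dvdn_divisors // in cm; rewrite dvdn_mul // dvdn_exp2l //.
  by move: ie; rewrite mem_iota.
have d0 := dvdn_gt0 N0 dN; have [c pc dE] := pfactor_coprime pp d0.
have ie : logn p d <= e.
  have := dvdn_leq_log p N0 dN; rewrite lognM ?expn_gt0 ?p0 // pfactorK //.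
  by rewrite (_ : logn p m = 0) ?addn0 // logn_coprime // prime_coprime.
exists (logn p d, c); split; rewrite ?mem_iota //=; last by rewrite mulnC.
rewrite -dvdn_divisors // -(@Gauss_dvdr _ (p ^ e)); last first.
  by rewrite coprime_sym coprimeXl.
by apply: dvdn_trans dN; rewrite [X in _ %| X]dE dvdn_mulr.
Qed.

(** * Representations by x^2 + 4z^2 and the congruence modulo 72 *)

Definition odd_representations (m : nat) : {set 'I_m.+1 * 'I_m.+1} :=
  [set x : 'I_m.+1 * 'I_m.+1 | (2 * x.1 + 1) ^ 2 + 4 * (2 * x.2 + 1) ^ 2 == 4 * m + 1].

(** A sum of this form is 5 mod 8, while 4m + 1 is 1 mod 8 for even m. *)
Lemma odd_representations0 (m : nat) : ~~ odd m -> #|odd_representations m| = 0.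
Proof.
move=> me; apply/eqP; rewrite cards_eq0; apply/eqP/setP => -[k l]; rewrite !inE /=.
by apply/negbTE/eqP; have := triangularE k; nia.
Qed.

(** Representations correspond to the Zagier triples with y = z, whose parity is that of the triples
    with x = y, that is, of the small divisors. *)
Lemma odd_odd_representations (m : nat) : odd m -> (forall k, k ^ 2 <> 4 * m + 1) ->
  odd #|odd_representations m| = odd (small_divisors (4 * m + 1)).
Proof.
move=> mo nsq; have N4 : (4 * m + 1) %% 4 = 1 by lia.
rewrite /small_divisors -(card_zagier_diag N4 nsq) -(odd_zagier N4 nsq); congr (odd _).
pose I := 'I_(4 * m + 1).+1; pose J := 'I_m.+1.
apply: (card_bij_in
  (f := fun x : J * J => (inord (2 * x.1 + 1), inord (2 * x.2 + 1), inord (2 * x.2 + 1)) : I * I * I)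
  (g := fun t : I * I * I => (inord (t.1.1)./2, inord (t.2)./2) : J * J)) => [[k l]|[[x y] z]].
  rewrite /odd_representations !in_set /= => /eqP E.
  have k1 : 2 * k + 1 < (4 * m + 1).+1 by nia.
  have l1 : 2 * l + 1 < (4 * m + 1).+1 by nia.
  rewrite !inordK // -mulnA mulnn E !eqxx; split=> //.
  have hE (i : J) : (2 * i + 1)./2 = i by lia.
  by rewrite !hE !inord_val.
move=> tA; have /andP[tS /eqP /= yz] : ((x, y, z) \in zagier_set (4 * m + 1)) && (y == z).
  by move: tA; rewrite in_set.
have [/= E x0 y0 z0 xo] := zagierP N4 nsq tS.
rewrite {}yz in E y0 tA tS *.
have xE : 2 * x./2 + 1 = x by have := odd_double_half x; rewrite xo; lia.
have x2 : x ^ 2 = 4 * (x./2 * (x./2).+1) + 1 by rewrite -{1}xE; lia.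
(* An even z would make 4m + 1 equal to 1 mod 8, against m odd. *)
have zo : odd z.
  apply/negPn/negP => ze; have zh := even_halfK ze; rewrite -mul2n in zh.
  have z2 : z ^ 2 = 4 * z./2 ^ 2 by rewrite -{1}zh expnMn.
  by have := triangularE x./2; lia.
have zE : 2 * z./2 + 1 = z by have := odd_double_half z; rewrite zo; lia.
have xl : x./2 < m.+1 by nia.
have zl : z./2 < m.+1 by nia.
rewrite /odd_representations !in_set /= !inordK // xE zE !inord_val; split=> //.
by apply/eqP; apply: etrans E; rewrite -mulnA mulnn.
Qed.

Local Open Scope ring_scope.

(** 36 is 0 mod 9 and 4 mod 8, so [b_mod9] and [b_mod8] combine. *)
Lemma b_mod72 (m : nat) : (m %% 3 = 2)%N -> (forall k, k ^ 2 <> 4 * m + 1)%N ->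
  (b (2 * m) = 36 * (odd m && odd (small_divisors (4 * m + 1)))%:Z %[mod 72])%Z.
Proof.
move=> m3 nsq; have /dvdzP[c cE] := b_mod9 m3.
have [|t tE] := @b_mod8 m; first by move=> k; apply/eqP/nsq.
rewrite -/(odd_representations m) in tE.
have pE : odd #|odd_representations m| = odd m && odd (small_divisors (4 * m + 1)).
  by case mo: (odd m); [rewrite odd_odd_representations | rewrite odd_representations0 ?mo].
rewrite -pE; move: #|_| tE => n tE; have := odd_double_half n.
by case: (odd n) => /= nE; lia.
Qed.

(** * Parity of g, powers of p, and the theorem *)

Lemma odd_g (p : nat) : odd p -> exists t : int, g p = 2 * t + 1.
Proof.
move=> op; have pE : p%:Z = 2 * (p./2)%:Z + 1 by lia.
have [s0 sE] : exists s0 : int, ss p = 2 * s0 + 1.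
  set h : int := (p./2)%:Z in pE; exists (4 * h ^+ 3 + 6 * h ^+ 2 + 3 * h).
  by rewrite /ss pE; ring.
rewrite /g sE /nu; move: (rr p) => r.
have [r8|r8] := eqVneq (r %% 8)%Z 0.
  by exists (- s0 - 1); rewrite /=; ring.
have [r4|r4] := eqVneq (r %% 8)%Z 4.
  have -> : r = 2 * (r %/ 2)%Z by lia.
  move: (r %/ 2)%Z => u; exists (- 2 * u ^+ 2 * (2 * s0 + 1) + 2 * s0 ^+ 2 + 2 * s0).
  by rewrite /=; ring.
rewrite /=; set s := 2 * s0 + 1; pose h := 2 * s0 ^+ 2 + 2 * s0.
(* The last branch of [nu] leaves the parity of r open; since s is odd, r^4 (5s - r^2) is even
   either way. *)
suff [t tE] : exists t, r ^+ 4 * (5 * s - r ^+ 2) = 2 * t.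
  exists (t * s - 3 * r ^+ 2 * s ^+ 3 + 2 * h ^+ 2 + 2 * h).
  transitivity (r ^+ 4 * (5 * s - r ^+ 2) * s - 6 * r ^+ 2 * s ^+ 3 + s ^+ 4); first by ring.
  by rewrite tE /h /s; ring.
have [rE|rE] : r = 2 * (r %/ 2)%Z \/ r = 2 * (r %/ 2)%Z + 1 by lia.
  move: (r %/ 2)%Z rE => u ->; exists (8 * u ^+ 4 * (5 * s - (2 * u) ^+ 2)); ring.
move: (r %/ 2)%Z rE => u ->.
exists ((2 * u + 1) ^+ 4 * (5 * s0 + 2 - 2 * u ^+ 2 - 2 * u)); rewrite /s; ring.
Qed.

Lemma nu_even (p : nat) : exists2 j, (2 * nu p = 4 * j)%N & (0 < j)%N.
Proof. by rewrite /nu; case: ifP => _; [exists 1%N | case: ifP => _; [exists 2%N | exists 4%N]]. Qed.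

Lemma logn_sqr_even (p N k : nat) : (k ^ 2 = N)%N -> ~~ odd (logn p N).
Proof. by move=> <-; rewrite lognX oddM. Qed.

Lemma expn_mod8 (p j : nat) : odd p -> (p ^ (4 * j) %% 8 = 1)%N.
Proof.
move=> op; have p2 : (p ^ 2 %% 8 = 1)%N.
  have pE : (p = 2 * p./2 + 1)%N by lia.
  by rewrite pE; have := triangularE p./2; lia.
have -> : (4 * j = 2 * (2 * j))%N by lia.
by rewrite expnM -modnXm p2 exp1n.
Qed.

Lemma odd_g_exp (p k : nat) : odd p -> exists t : int, g p ^+ k = 2 * t + 1.
Proof.
move=> /odd_g [s sE]; elim: k => [|k [t tE]]; first by exists 0.
by exists (2 * s * t + s + t); rewrite exprS tE sE; ring.
Qed.

Lemma nonsquare_mod4 (n i : nat) : (i ^ 2 <> 4 * n + 3)%N.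
Proof.
have := odd_double_half i; case: (odd i) => /= <-; move: (i./2) => h E.
  by lia.
by lia.
Qed.

(** In both parts the index is 2m with N = 4m + 1 a nonsquare multiple of 9, so [b_mod72] applies;
    the parity of [small_divisors N] is that of half the number of divisors of N, so this number is
    needed mod 4. *)
Theorem theorem1p12 (p : nat) (hp : prime p) (hp3 : (3 <= p)%N) :
  (forall n k : nat, ~~ (p %| n)%N ->
     (b (18 * p ^ (2 * nu p * k.+1 - 1) * n
         + (9 * p ^ (2 * nu p * k.+1) - 1) %/ 2)%N
      = 0 %[mod 72])%Z)
  /\
  (forall k : nat,
     (b (18 * p ^ (2 * nu p * k) + (9 * p ^ (2 * nu p * k) - 1) %/ 2)%N
      = 36 * g p ^+ k %[mod 72])%Z).
Proof.
have op : odd p by case: (even_prime hp) hp3 => // ->.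
have [j jE j0] := nu_even p; rewrite !jE.
have p0 : (0 < p)%N by lia.
split=> [n k pn | k].
  set e := (4 * j * k.+1 - 1)%N.
  have eE : (4 * j * k.+1 = e.+1)%N by rewrite /e; nia.
  (* Makes the division by 4 in [m] exact. *)
  have p8 : (p ^ e.+1 %% 8 = 1)%N by rewrite -eE -mulnA expn_mod8.
  rewrite eE; pose m := (9 * p ^ e * n + (9 * p ^ e.+1 - 1) %/ 4)%N.
  have -> : (18 * p ^ e * n + (9 * p ^ e.+1 - 1) %/ 2 = 2 * m)%N by rewrite /m; lia.
  have NE : (4 * m + 1 = p ^ e * (9 * (4 * n + p)))%N.
    have : (4 * m + 1 = 36 * (p ^ e * n) + 9 * p ^ e.+1)%N by rewrite /m; lia.
    by rewrite expnS; lia.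
  have pn4 : ~~ (p %| 4 * n + p)%N.
    rewrite dvdn_addl // Gauss_dvdr // coprime_sym (@coprimeXl 2 2 p) //.
    by rewrite coprime2n.
  (* The exponent of p in N is e, which is odd, plus the even exponent of p in 9. *)
  have nsq i : (i ^ 2 <> 4 * m + 1)%N.
    move/(logn_sqr_even p); rewrite NE !lognM ?expn_gt0 ?p0 ?muln_gt0 ?addn_gt0 ?p0 ?orbT //.
    rewrite pfactorK // (@lognX p 3 2) (_ : logn p (4 * n + p) = 0)%N; last first.
      by apply/eqP; rewrite lognE hp (negbTE pn4) andbF.
    by rewrite addn0 oddD oddM addbF; lia.
  rewrite b_mod72 //; last by lia.
  suff -> : odd (small_divisors (4 * m + 1)) = false by rewrite andbF mulr0.
  have N0 : (0 < 4 * m + 1)%N by rewrite addn1.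
  have := size_divisors_nonsquare N0 nsq.
  (* For p = 3 the factor 9 joins the power of p: the number of divisors is e + 3 times that of 4n +
     3, both even. For other p the factor e + 1 is already a multiple of 4. *)
  have [p3|p3] := eqVneq p 3%N.
    have -> : (4 * m + 1 = p ^ e.+2 * (4 * n + p))%N.
      by rewrite NE !expnS p3; lia.
    rewrite size_divisors_pfactor ?addn_gt0 ?p0 ?orbT //.
    have -> : (divisors (4 * n + p) = divisors (4 * n + 3))%N by rewrite p3.
    rewrite (size_divisors_nonsquare _ (@nonsquare_mod4 n)) ?addn3 //.
    by rewrite -eE; nia.
  have p9 : ~~ (p %| 9 * (4 * n + p))%N.
    rewrite Euclid_dvdM // negb_or pn4 andbT (Euclid_dvdX 3 2) // andbT.
    by rewrite dvdn_prime2.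
  rewrite NE size_divisors_pfactor ?muln_gt0 ?addn_gt0 ?p0 ?orbT // -eE => sE.
  have : (small_divisors (p ^ e * (9 * (4 * n + p)))
    = 2 * (j * k.+1 * size (divisors (9 * (4 * n + p)))))%N by lia.
  by move=> ->; rewrite oddM.
set e := (4 * j * k)%N.
have p8 : (p ^ e %% 8 = 1)%N by rewrite /e -mulnA expn_mod8.
pose m := (9 * p ^ e + (9 * p ^ e - 1) %/ 4)%N.
have -> : (18 * p ^ e + (9 * p ^ e - 1) %/ 2 = 2 * m)%N by rewrite /m; lia.
have NE : (4 * m + 1 = p ^ e * 45)%N by rewrite /m; lia.
have mo : odd m by lia.
have eo : odd e = false by rewrite /e -mulnA oddM.
(* The exponent of 5 in 45 p^e is odd, as e is even. *)
have nsq i : (i ^ 2 <> 4 * m + 1)%N.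
  move/(logn_sqr_even 5); rewrite NE lognM ?expn_gt0 ?p0 // lognX oddD oddM eo.
  by rewrite (_ : logn 5 45 = 1)%N.
have N0 : (0 < 4 * m + 1)%N by rewrite addn1.
have sE := size_divisors_nonsquare N0 nsq.
rewrite b_mod72 //; last by lia.
have [t ->] := odd_g_exp k op.
suff -> : odd (small_divisors (4 * m + 1)) by rewrite mo; lia.
(* The numbers of divisors for p = 3, p = 5 and all other p are 2(e + 3), 3(e + 2) and 6(e + 1),
   each 2 mod 4 because 4 divides e. *)
move: sE; have [p3|p3] := eqVneq p 3%N.
  have -> : (4 * m + 1 = p ^ e.+2 * 5)%N by rewrite NE !expnS p3; lia.
  rewrite size_divisors_pfactor ?p3 // (_ : size (divisors 5) = 2) //.
  by lia.
have [p5|p5] := eqVneq p 5%N.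
  have -> : (4 * m + 1 = p ^ e.+1 * 9)%N by rewrite NE !expnS p5; lia.
  rewrite size_divisors_pfactor ?p5 // (_ : size (divisors 9) = 3) //.
  by rewrite /e; lia.
rewrite NE size_divisors_pfactor //; last first.
  by rewrite (_ : 45 = 3 ^ 2 * 5)%N // Euclid_dvdM // Euclid_dvdX // !dvdn_prime2 // andbT negb_or p3.
by rewrite (_ : size (divisors 45) = 6) //; lia.
Qed.
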